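(* Almost surely, for $\varrho$-almost all $\lambda\in\mathbb R$ and for every $i\le I(\lambda)$, the generalized eigenfunction $f^{(i)}_\lambda$ of $\mathcal H=-\partial_x^2+\xi$ satisfies $$\frac{\ln(1+|f^{(i)}_\lambda(x)|)}{|x|}\longrightarrow0\quad\text{as }x\to\pm\infty .$$
   Context: Let $\xi$ be a Gaussian white noise on $\mathbb R$ and let $B(t)=\langle\xi,\mathbf 1_{[0,t]}\rangle$ be the associated continuous two-sided Brownian motion with $B(0)=0$ (with $B(t)=-\langle\xi,\mathbf 1_{[t,0]}\rangle$ for $t<0$). For $f$ such that $f$ and $f'-Bf$ are locally absolutely continuous, set $\tau f:=-(f'-Bf)'-Bf'$ (the rigorous meaning of $-f''+\xi f$). The operator $\mathcal Hf:=\tau f$ on $\mathcal D=\{f\in L^2(\mathbb R):\ f,\ f'-Bf\text{ locally absolutely continuous},\ \tau f\in L^2(\mathbb R)\}$ is almost surely self-adjoint; $E(d\lambda)$ denotes its projection-valued measure. A spectral measure of $\mathcal H$ is a non-negative Radon measure $\varrho$ on $\mathbb R$ with $\varrho(A)=0\Leftrightarrow E(A)=0$ for all Borel sets $A$. Generalized eigenfunctions: almost surely there exist a spectral measure $\varrho$ and a jointly measurable function $(\lambda,x,y)\mapsto E(\lambda,x,y)$ such that for all bounded measurable compactly supported $f,g:\mathbb R\to\mathbb R$ and all bounded Borel sets $A$, $$\langle f,E(A)g\rangle=\int_{\mathbb R}\mathbf 1_A(\lambda)\int_{\mathbb R^2}E(\lambda,x,y)f(x)g(y)\,dx\,dy\,\varrho(d\lambda),$$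 and such that for $\varrho$-a.a. $\lambda$, $E(\lambda,x,y)=\sum_{i=1}^{I(\lambda)}f^{(i)}_\lambda(x)f^{(i)}_\lambda(y)$, where $I(\lambda)\in\{1,2\}$ and the $f^{(i)}_\lambda$ are linearly independent solutions of $-y''+\xi y=\lambda y$ (that is, $y$ and $y'-By$ are locally absolutely continuous and $\tau y=\lambda y$). The $\varrho$, $I(\lambda)$ and $f^{(i)}_\lambda$ of the claim are those of such a disintegration. *)

(* Defs.v *)
From HB Require Import structures.
From mathcomp Require Import all_boot all_order all_algebra.
From mathcomp Require Import all_classical all_reals all_analysis.
Set Implicit Arguments.
Unset Strict Implicit.
Unset Printing Implicit Defensive.
Import Order.TTheory GRing.Theory Num.Theory.
Import numFieldNormedType.Exports.
Local Open Scope classical_set_scope.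
Local Open Scope ring_scope.

(** A point of the real Hilbert space L^2(R) is given by a (Borel)
    square-integrable function; equality in L^2(R) is almost everywhere equality
    of representatives, and is always written out as [%[ae leb]]. *)

Notation leb := (@lebesgue_measure _).

Notation L2 R :=
  (@LfunType _ (measurableTypeR R) R (@lebesgue_measure R) 2%:E (lee1n 2)).

Definition ip (R : realType) (f g : L2 R) : R :=
  \int[leb]_x (f x * g x).

Lemma indic_itv_Lfun (R : realType) (a b : R) :
  \1_`[a, b] \in Lfun (@lebesgue_measure R) 2%:E.
Proof.
rewrite inE; apply/andP; split; rewrite inE//=.
rewrite /finite_norm unlock /= poweR_lty//.
have -> : (\int[leb]_x ((`|\1_`[a, b] x| `^ 2)%:E) =
    \int[leb]_x ((\1_`[a, b] x : R)%:E) :> \bar R)%E.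
  apply: eq_integral => x _; rewrite indicE; case: (x \in _) => /=.
    by rewrite normr1 powR1.
  by rewrite normr0 powR0.
rewrite integral_indic// setIT.
rewrite [X in (X < _)%E](lebesgue_measure_itv `[a, b])/=.
by case: ifP => _; rewrite ?ltry.
Qed.

Definition indic_itv (R : realType) (a b : R) : L2 R :=
  Lfun_Sub (lee1n 2) (indic_itv_Lfun a b).

(** [s] is the standard deviation; the library's [normal_prob m 0] is not the
    point mass at [m]. *)
Definition gaussian_law (R : realType) (m s : R) : set R -> \bar R :=
  if s == 0 then dirac m else normal_prob m s.

(** White noise as the isonormal Gaussian process over L^2(R): a jointly
    Gaussian, centred family with covariance the inner product. *)
Definition white_noise (R : realType) (d : measure_display)
    (Omega : measurableType d) (P : probability Omega R)
    (xi : L2 R -> {RV P >-> R}) : Prop :=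
  [/\ forall (n : nat) (u : 'I_n -> L2 R) (c : 'I_n -> R),
        exists m s : R, 0 <= s /\
          forall A : set R, measurable A ->
            P [set w | A (\sum_(i < n) c i * xi (u i) w)] = gaussian_law m s A,
      forall u : L2 R, ('E_P[xi u] = 0)%E
    & forall u v : L2 R, covariance P (xi u) (xi v) = (ip u v)%:E].

Definition brownian_of (R : realType) (d : measure_display)
    (Omega : measurableType d) (P : probability Omega R)
    (xi : L2 R -> {RV P >-> R}) (B : R -> {RV P >-> R}) : Prop :=
  [/\ {ae P, forall w, B 0 w = 0 /\ continuous (fun t : R => B t w)},
      forall t : R, 0 <= t -> {ae P, forall w, B t w = xi (indic_itv 0 t) w}
    & forall t : R, t < 0 -> {ae P, forall w, B t w = - xi (indic_itv t 0) w}].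

Definition abs_continuous (R : realType) (a b : R) (f : R -> R) : Prop :=
  forall e : R, 0 < e -> exists2 delta : R, 0 < delta &
    forall (n : nat) (s t : 'I_n -> R),
      (forall i, [/\ a <= s i, s i <= t i & t i <= b]) ->
      trivIset [set: 'I_n] (fun i => `]s i, t i[%classic) ->
      \sum_(i < n) (t i - s i) < delta ->
      \sum_(i < n) `|f (t i) - f (s i)| < e.

Definition loc_abs_continuous (R : realType) (f : R -> R) : Prop :=
  forall a b : R, a <= b -> abs_continuous a b f.

(** [derive1] is total. If [f] and [quasi_deriv b f] are locally absolutely
    continuous and [b] is continuous, then [f] is C^1 and [tau b f] has its
    meaning almost everywhere; [tau b f] is only used up to null sets. *)
Definition quasi_deriv (R : realType) (b f : R -> R) : R -> R :=
  fun x => derive1 f x - b x * f x.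

Definition tau (R : realType) (b f : R -> R) : R -> R :=
  fun x => - derive1 (quasi_deriv b f) x - b x * derive1 f x.

(** The graph of H: the class [u] is in the domain, with H u = [v]; [f] is the
    locally absolutely continuous representative of [u]. *)
Definition anderson (R : realType) (b : R -> R) (u v : L2 R) : Prop :=
  exists f : R -> R,
    [/\ (u : R -> R) = f %[ae leb],
        loc_abs_continuous f,
        loc_abs_continuous (quasi_deriv b f)
      & (v : R -> R) = tau b f %[ae leb] ].

Definition solution (R : realType) (b : R -> R) (l : R) (y : R -> R) : Prop :=
  [/\ loc_abs_continuous y,
      loc_abs_continuous (quasi_deriv b y)
    & tau b y = (fun x => l * y x) %[ae leb] ].

Record is_pvm (R : realType) (E : set R -> L2 R -> L2 R) : Prop := IsPvm {
  pvm_ae : forall (A : set R) (f g : L2 R), measurable A ->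
    (f : R -> R) = g %[ae leb] -> (E A f : R -> R) = E A g %[ae leb];
  pvm_linear : forall (A : set R) (a : R) (f g : L2 R), measurable A ->
    (E A (a *: f + g) : R -> R) = (a *: E A f + E A g : L2 R) %[ae leb];
  pvm_sym : forall (A : set R) (f g : L2 R), measurable A ->
    ip (E A f) g = ip f (E A g);
  pvm_idem : forall (A : set R) (f : L2 R), measurable A ->
    (E A (E A f) : R -> R) = E A f %[ae leb];
  pvm_set0 : forall f : L2 R, (E set0 f : R -> R) = (0 : L2 R) %[ae leb];
  pvm_setT : forall f : L2 R, (E setT f : R -> R) = f %[ae leb];
  pvm_setI : forall (A C : set R) (f : L2 R), measurable A -> measurable C ->
    (E (A `&` C) f : R -> R) = E A (E C f) %[ae leb];
  pvm_sigma_additive : forall (F : nat -> set R) (f : L2 R),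
    (forall n, measurable (F n)) -> trivIset setT F ->
    ('N[leb]_2%:E[ EFin \o
       (E (\bigcup_k F k) f - \sum_(i < n) E (F i) f : L2 R)%R ])%E
      @[n --> \oo] --> 0%E }.

Definition pvm_diag (R : realType) (E : set R -> L2 R -> L2 R) (f : L2 R) :
    set (measurableTypeR R) -> \bar R :=
  fun A => (ip f (E A f))%:E.

(** [E] is the projection-valued measure of the operator with graph [H], that
    is H = \int l E(dl): the domain of [H] is {f | \int l^2 <f, E(dl) f> < oo}
    and <g, H f> = \int l <g, E(dl) f>. The signed measure <g, E(dl) f> is
    written as (pvm_diag E (f + g) - pvm_diag E (f - g)) / 4; testing against
    [g] in the domain determines [H f] because the domain is dense. *)
Definition pvm_of (R : realType) (H : L2 R -> L2 R -> Prop)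
    (E : set R -> L2 R -> L2 R) : Prop :=
  [/\ is_pvm E,
      forall f : L2 R, (exists h, H f h) <->
        (\int[pvm_diag E f]_l (l ^+ 2)%:E < +oo)%E
    & forall f h g k : L2 R, H f h -> H g k ->
        ((4 * ip g h)%:E = \int[pvm_diag E (f + g)%R]_l l%:E
                           - \int[pvm_diag E (f - g)%R]_l l%:E)%E ].

(** On R, a Radon measure is a Borel measure that is finite on compact sets. *)
Definition spectral_measure (R : realType) (E : set R -> L2 R -> L2 R)
    (rho : {measure set (measurableTypeR R) -> \bar R}) : Prop :=
  (forall K : set R, compact K -> (rho K < +oo)%E) /\
  (forall A : set R, measurable A ->
     rho A = 0%E <-> (forall f : L2 R, (E A f : R -> R) = (0 : L2 R) %[ae leb])).

Definition bounded_compact_support (R : realType) (f : R -> R) : Prop :=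
  (exists M : R, forall x, `|f x| <= M) /\
  (exists M : R, forall x, M < `|x| -> f x = 0).

Definition lin_indep (R : realType) (n : nat) (f : 'I_n -> R -> R) : Prop :=
  forall c : 'I_n -> R,
    (forall x, \sum_(i < n) c i * f i x = 0) -> forall i, c i = 0.

(** [K l x y] is the kernel E(lambda, x, y) and [m l] is the multiplicity
    I(lambda). A bounded Borel function with compact support is in L^2(R), so
    that the test functions [f], [g] are taken in [L2 R]. *)
Record eigen_disintegration (R : realType) (b : R -> R)
    (E : set R -> L2 R -> L2 R)
    (rho : {measure set (measurableTypeR R) -> \bar R})
    (K : R -> R -> R -> R) (m : R -> nat)
    (phi : forall l : R, 'I_(m l) -> R -> R) : Prop := EigenDisintegration {
  disint_measurable : measurable_fun setT
    (fun z : measurableTypeR R * measurableTypeR R * measurableTypeR R =>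
       K z.1.1 z.1.2 z.2 : R);
  disint_kernel : forall (f g : L2 R) (A : set R),
    bounded_compact_support f -> bounded_compact_support g ->
    measurable A -> bounded_set A ->
    ((ip f (E A g))%:E =
     \int[rho]_l ((\1_A l)%:E *
        \int[leb \x leb]_z (K l z.1 z.2 * f z.1 * g z.2)%:E))%E;
  disint_eigenfunctions : {ae rho, forall l,
    [/\ (m l = 1 \/ m l = 2)%N,
        forall i, solution b l (phi l i),
        lin_indep (phi l)
      & forall x y, K l x y = \sum_(i < m l) phi l i x * phi l i y] } }.

(* Main.v *)
Require Import Defs.
From HB Require Import structures.
From mathcomp Require Import all_boot all_order all_algebra.
From mathcomp Require Import all_classical all_reals all_analysis.
From mathcomp Require Import measurable_realfun ring lra zify.
Import Order.TTheory GRing.Theory Num.Theory.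
Import numFieldNormedType.Exports.
Local Open Scope classical_set_scope.
Local Open Scope ring_scope.

Set Implicit Arguments.
Unset Strict Implicit.
Unset Printing Implicit Defensive.

(** Why the eigenfunctions cannot grow exponentially.

    Let [A] be a bounded Borel set of energies and [f] the indicator of a short
    interval [I]. A spectral projection is a contraction, so the kernel formula
    for [<f, E(A) f>] reads
      \int_A sum_i (\int_I phi_i)^2 d rho = <f, E(A) f> <= |I|.
    This is the only information on the eigenfunctions that comes from the
    operator. Apply it to all cells of the grids of mesh [1/n] on [[-n, n]], for
    all [n], with weights that make the right-hand sides summable: the weighted
    series of squares is integrable, hence finite for almost every energy in
    [A], and the averages of the eigenfunctions over the cells of the n-th grid
    are at most a constant times [n^2] ([eigenfunction_averages_bounded]).

    Averages become pointwise bounds through the equation. Write it as the first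
    order system [y' = z + B y], [z' = - l y - B y']. If the averages of [y] over
    two nearby cells are small, then [y] is small at two points, so [y'] is
    small at a point in between, and these values propagate over a distance that
    is short compared with [1/B] and [1/|l|] ([solution_local_bound]). Along the
    grid of mesh [1/n] with [n] of the order of [1 + |x|] this is possible as soon
    as [B] grows at most linearly, and it gives a polynomial bound on [y]
    ([solution_poly_growth]), far better than what is claimed.

    That almost every Brownian path grows at most linearly
    ([brownian_linear_growth]) is a form of the Kolmogorov-Chentsov argument:
    a Gaussian increment of variance [h] has a fourth moment of order [h^2], so that the weighted sum of the fourth powers of all dyadic
    increments on all intervals [[0, N]] has finite expectation; chaining along
    dyadic points turns the bound on these increments into one on the path.

    One point of real analysis is hidden in the word solution. The derivatives
    in the equation are total functions, with value zero where no derivative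
    exists, and the equation holds almost everywhere. Recovering [y] and [z] from
    it requires that an absolutely continuous function is differentiable almost
    everywhere and is the integral of its derivative. For this, such a function
    is written as a difference of nondecreasing ones through its total variation;
    the Stieltjes measure of each is dominated by Lebesgue measure
    ([lebesgue_stieltjes_null]), so that the Radon-Nikodym theorem provides a
    density and Lebesgue differentiation identifies it
    ([abs_continuous_derivable_ae]). *)

(** * Total variation of absolutely continuous functions *)

(** Families of intervals obtained by refining others are naturally indexed by
    dependent pairs, so the index type is freed here. *)
Lemma abs_continuous_fin (R : realType) (a b : R) (f : R -> R) :
  abs_continuous a b f -> forall e : R, 0 < e -> exists2 delta : R, 0 < delta &
    forall (T : finType) (s t : T -> R),
      (forall i, [/\ a <= s i, s i <= t i & t i <= b]) ->
      trivIset [set: T] (fun i => `]s i, t i[%classic) ->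
      \sum_i (t i - s i) < delta ->
      \sum_i `|f (t i) - f (s i)| < e.
Proof.
move=> acf e e0; have [delta d0 H] := acf e e0; exists delta => // T s t st tr.
have reidx (F : T -> R) : \sum_i F i = \sum_(k < #|T|) F (enum_val k).
  by rewrite -(big_enum_val F).
rewrite !reidx => ls.
apply: (H #|T| (s \o enum_val) (t \o enum_val)) => //=.
move=> i j _ _ ij; apply: enum_val_inj; exact: tr ij.
Qed.

Lemma itv_partition_nth_mono (R : realType) (s t : R) (l : seq R) :
  itv_partition s t l ->
  forall i j : nat, (i <= j)%N -> (j <= size l)%N ->
  nth t (s :: l) i <= nth t (s :: l) j.
Proof.
move=> [pl _] i j ij jl.
apply: (@sorted_leq_nth _ <=%O _ _ t (s :: l)) => //=.
- exact: le_trans.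
- by apply: sub_path pl => x y /ltW.
- by rewrite inE/= ltnS (leq_trans ij).
Qed.

Lemma itv_partition_cells_trivIset (R : realType) (s t : R) (l : seq R) :
  itv_partition s t l ->
  trivIset [set: 'I_(size l)]
    (fun k => `]nth t (s :: l) k, nth t (s :: l) k.+1[%classic).
Proof.
move=> pl i j _ _ [x []] /=; rewrite !in_itv/= => /andP[xi ix] /andP[xj jx].
apply/val_inj => /=; case: (ltngtP i j) => // ij; exfalso.
  have := @itv_partition_nth_mono _ _ _ _ pl i.+1 j ij (ltnW (ltn_ord j)).
  by rewrite leNgt (lt_trans xj ix).
have := @itv_partition_nth_mono _ _ _ _ pl j.+1 i ij (ltnW (ltn_ord i)).
by rewrite leNgt (lt_trans xi jx).
Qed.

Lemma itv_partition_telescope (R : realType) (s t : R) (l : seq R) :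
  itv_partition s t l ->
  \sum_(k < size l) (nth t (s :: l) k.+1 - nth t (s :: l) k) = t - s.
Proof.
move=> pl; rewrite -(big_mkord xpredT
  (fun k => nth t (s :: l) k.+1 - nth t (s :: l) k)) telescope_sumr//.
by rewrite (itv_partition_nth_size _ pl).
Qed.

(** The suprema may be infinite a priori, so one cannot pick near-optimal
    elements; instead the suprema are taken one coordinate after the other. *)
Lemma sum_ereal_sup_le (R : realType) (n : nat) (S : 'I_n -> set R) (c : R) :
  (forall i, S i !=set0) ->
  (forall x : 'I_n -> R, (forall i, S i (x i)) -> \sum_i x i <= c) ->
  (\sum_i ereal_sup [set x%:E | x in S i] <= c%:E)%E.
Proof.
elim: n S c => [|n IH] S c S0 H.
  by rewrite big_ord0; have := H (fun=> 0) (fun i => False_ind _ (notF (valP i)));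
    rewrite big_ord0 lee_fin.
rewrite big_ord_recl.
set rest := (\sum_(i < n) _)%E.
have restle x0 : S ord0 x0 -> (rest <= (c - x0)%:E)%E.
  move=> Sx0; apply: (IH (fun i => S (lift ord0 i))) => // x Sx.
  rewrite lerBrDl.
  have := H (fun i => oapp x x0 (unlift ord0 i)).
  rewrite big_ord_recl unlift_none/=.
  under eq_bigr do rewrite liftK/=.
  apply=> i; case: (unliftP ord0 i) => [j ->|->]/=; last exact: Sx0.
  exact: Sx.
have rest_gt : (-oo < rest)%E.
  have [x Sx] := choice (fun i => S0 (lift ord0 i)).
  apply: (@lt_le_trans _ _ (\sum_(i < n) (x i)%:E)%E).
    by rewrite sumEFin ltNyr.
  by apply: lee_sum => i _; apply: ereal_sup_ubound; exists (x i).
have [x0 Sx0] := S0 ord0.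
have restfin : rest \is a fin_num.
  by rewrite fin_numE -ltNye rest_gt/= -ltey (le_lt_trans (restle _ Sx0))// ltry.
rewrite -(fineK restfin) -leeBrDr// -EFinB.
apply: ge_ereal_sup => _ [y Sy <-]; rewrite lee_fin lerBrDr -lerBrDl.
by have := restle _ Sy; rewrite -(fineK restfin) lee_fin.
Qed.

(** Refining each interval of a short family by a partition leaves the total
    length unchanged, so absolute continuity applies to all refinements at once,
    and hence to the suprema over them. *)
Lemma abs_continuous_total_variation (R : realType) (a b : R) (f : R -> R) :
  abs_continuous a b f -> forall e : R, 0 < e -> exists2 delta : R, 0 < delta &
    forall (n : nat) (s t : 'I_n -> R),
      (forall i, [/\ a <= s i, s i <= t i & t i <= b]) ->
      trivIset [set: 'I_n] (fun i => `]s i, t i[%classic) ->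
      \sum_(i < n) (t i - s i) < delta ->
      (\sum_(i < n) total_variation (s i) (t i) f <= e%:E)%E.
Proof.
move=> acf e e0; have [delta d0 H] := abs_continuous_fin acf e0.
exists delta => // n s t st tr lst.
apply: sum_ereal_sup_le => [i|x xP].
  have [_ + _] := st i; rewrite le_eqVlt => /predU1P[->|sti].
    by rewrite variationsxx; exists 0.
  exact: variations_neq0.
have [l lP] : {l : 'I_n -> seq R & forall i, itv_partition (s i) (t i) (l i) /\
    variation (s i) (t i) f (l i) = x i}.
  apply: (@choice _ _ (fun i l => itv_partition (s i) (t i) l /\
    variation (s i) (t i) f l = x i)) => i.
  by have [l pl lx] := xP i; exists l.
(* one interval of the refined family per cell of one of the partitions *)
pose T := {i : 'I_n & 'I_(size (l i))}.
pose N (i : 'I_n) k := nth (t i) (s i :: l i) k.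
have Nin (i : 'I_n) k : (k <= size (l i))%N -> s i <= N i k /\ N i k <= t i.
  move=> kl; have [pl _] := lP i.
  split; [exact: itv_partition_nth_ge pl|exact: itv_partition_nth_le pl].
have -> : \sum_i x i = \sum_(k : T) `|f (N (tag k) (tagged k).+1) -
    f (N (tag k) (tagged k))|.
  rewrite -(@sig_big_dep _ _ _ _ _ (fun=> true) (fun=> fun=> true)
    (fun i (k : 'I_(size (l i))) => `|f (N i k.+1) - f (N i k)|))/=.
  by apply: eq_bigr => i _; rewrite -(lP i).2 /variation big_mkord.
apply/ltW/(H T (fun k => N (tag k) (tagged k))
    (fun k => N (tag k) (tagged k).+1)).
- case=> i k /=; have [si _] := Nin i k (ltnW (ltn_ord k)).
  have [_ ti] := Nin i k.+1 (ltn_ord k); have [asi _ tib] := st i.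
  split; [exact: le_trans si| |exact: le_trans tib].
  by apply: itv_partition_nth_mono (lP i).1 _ _ _ _.
- case=> i k [j k'] _ _ /= [z []].
  rewrite /= !in_itv/= => /andP[zi iz] /andP[zj jz].
  have ij : i = j.
    apply: tr => //; exists z; split; rewrite /= in_itv/=.
      have [si _] := Nin i k (ltnW (ltn_ord k)).
      have [_ ti] := Nin i k.+1 (ltn_ord k).
      by rewrite (le_lt_trans si zi) (lt_le_trans iz ti).
    have [si _] := Nin j k' (ltnW (ltn_ord k')).
    have [_ ti] := Nin j k'.+1 (ltn_ord k').
    by rewrite (le_lt_trans si zj) (lt_le_trans jz ti).
  case: _ / ij k' zj jz => k' zj jz; congr existT.
  apply: (itv_partition_cells_trivIset (lP i).1) => //.
  by exists z; split; rewrite /= in_itv/= ?zi ?zj.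
- rewrite -(@sig_big_dep _ _ _ _ _ (fun=> true) (fun=> fun=> true)
    (fun i (k : 'I_(size (l i))) => N i k.+1 - N i k))/=.
  by under eq_bigr do rewrite (itv_partition_telescope (lP _).1).
Qed.

Lemma trivIset_ord1 (T : Type) (F : 'I_1 -> set T) : trivIset [set: 'I_1] F.
Proof. by move=> i j _ _ _; rewrite !ord1. Qed.

(** On a short interval the variation is at most one, by the previous lemma for
    a single interval; finitely many short intervals fill [[a, b]]. *)
Lemma abs_continuous_bounded_variation (R : realType) (a b : R) (f : R -> R) :
  a <= b -> abs_continuous a b f -> bounded_variation a b f.
Proof.
move=> ab /abs_continuous_total_variation/(_ _ ltr01)[delta d0 H].
apply/bounded_variationP => //.
have short s t : a <= s -> s <= t -> t <= b -> t - s < delta ->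
    total_variation s t f \is a fin_num.
  move=> sa st tb std; rewrite ge0_fin_numE ?total_variation_ge0//.
  have := H 1%N (fun=> s) (fun=> t) (fun=> And3 sa st tb) (@trivIset_ord1 _ _).
  by rewrite !big_ord_recl !big_ord0 addr0 adde0 => /(_ std)/le_lt_trans; apply;
    rewrite ltry.
pose N := Num.truncn ((b - a) / delta).
have Nd : (b - a) / N.+1%:R < delta.
  by rewrite ltr_pdivrMr// -ltr_pdivrMl// mulrC truncnS_gt.
have hN0 : 0 <= (b - a) / N.+1%:R by rewrite divr_ge0// subr_ge0.
pose c k := a + k%:R * ((b - a) / N.+1%:R).
have cS k : c k.+1 = c k + (b - a) / N.+1%:R by rewrite /c -natr1; ring.
have cb : c N.+1 = b by rewrite /c mulrC divfK ?pnatr_eq0//; ring.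
have ca k : a <= c k by rewrite /c lerDl mulr_ge0.
have cle k : (k <= N.+1)%N -> c k <= b.
  by move=> kN; rewrite -cb /c lerD2l ler_wpM2r// ler_nat.
rewrite -cb; move: (leqnn N.+1).
elim: {1 3}N.+1 => [|k IH] kN.
  by rewrite /c mul0r addr0 total_variationxx.
have ck : c k <= c k.+1 by rewrite cS lerDl.
rewrite (total_variationD f (ca k) ck) fin_numD IH 1?ltnW//=.
by apply: short => //; [exact: cle|rewrite cS addrAC subrr add0r].
Qed.

(** Precomposition with [clamp] extends a function on [[a, b]] by constants;
    Stieltjes measures need functions that are monotone on the whole line. *)
Definition clamp (R : realType) (a b x : R) : R := Num.max a (Num.min x b).

Section clamp.
Context {R : realType} (a b : R).
Hypothesis ab : a <= b.

Lemma clamp_ge x : a <= clamp a b x.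
Proof. by rewrite /clamp le_max lexx. Qed.

Lemma clamp_le x : clamp a b x <= b.
Proof. by rewrite /clamp ge_max ab ge_min lexx orbT. Qed.

Lemma clamp_homo x y : x <= y -> clamp a b x <= clamp a b y.
Proof.
move=> xy; rewrite /clamp /Num.max /Num.min.
by repeat case: ifPn; rewrite -?leNgt => *; lra.
Qed.

Lemma clamp_id x : a <= x -> x <= b -> clamp a b x = x.
Proof. by move=> ax xb; rewrite /clamp (min_idPl xb) (max_idPr ax). Qed.

Lemma clamp_sub x y : x <= y -> clamp a b y - clamp a b x <= y - x.
Proof.
rewrite /clamp /Num.max /Num.min => xy.
by repeat case: ifPn; rewrite -?leNgt => *; lra.
Qed.

Lemma clampK x : clamp a b (clamp a b x) = clamp a b x.
Proof. by rewrite clamp_id ?clamp_ge ?clamp_le. Qed.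
End clamp.

Lemma abs_continuous_clamp_continuous (R : realType) (a b : R) (g : R -> R) :
  a <= b -> abs_continuous a b g -> (forall x, g (clamp a b x) = g x) ->
  continuous g.
Proof.
move=> ab acg gc x.
apply/cvgrPdist_lt => e e0; have [delta d0 H] := acg e e0.
have {}H s t : s <= t -> t - s < delta -> `|g t - g s| < e.
  move=> st std.
  have := H 1%N (fun=> clamp a b s) (fun=> clamp a b t)
    (fun=> And3 (clamp_ge _ _ s) (clamp_homo a b st) (clamp_le ab t))
    (@trivIset_ord1 _ _).
  rewrite !big_ord_recl !big_ord0 !addr0 !gc; apply.
  exact: le_lt_trans (clamp_sub a b st) std.
near=> y.
have xyd : `|x - y| < delta by near: y; apply/nbhs_ballP; exists delta => /=.
have [xy|yx] := leP x y.
  by rewrite distrC; apply: H => //; move: xyd; rewrite distrC ger0_norm ?subr_ge0.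
by apply: H; [exact: ltW|move: xyd; rewrite gtr0_norm ?subr_gt0].
Unshelve. all: end_near. Qed.

Lemma abs_continuousB (R : realType) (a b : R) (f g : R -> R) :
  abs_continuous a b f -> abs_continuous a b g -> abs_continuous a b (f \- g).
Proof.
move=> acf acg e e0; have e2 : 0 < e / 2 by rewrite divr_gt0.
have [d1 d10 H1] := acf _ e2; have [d2 d20 H2] := acg _ e2.
exists (Num.min d1 d2); first by rewrite lt_min d10.
move=> n s t st tr; rewrite lt_min => /andP[l1 l2].
rewrite (splitr e); apply: (le_lt_trans _
  (ltrD (H1 n s t st tr l1) (H2 n s t st tr l2))).
rewrite -big_split/=; apply: ler_sum => i _.
rewrite (_ : _ - _ - _ = (f (t i) - f (s i)) - (g (t i) - g (s i))); last by ring.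
exact: ler_normB.
Qed.

Lemma eq_abs_continuous (R : realType) (a b : R) (f g : R -> R) :
  (forall x, a <= x -> x <= b -> f x = g x) ->
  abs_continuous a b f -> abs_continuous a b g.
Proof.
move=> fg acf e e0; have [d d0 H] := acf _ e0; exists d => // n s t st tr l.
rewrite (eq_bigr (fun i => `|f (t i) - f (s i)|)) ?H// => i _.
have [asi sti tib] := st i.
by rewrite !fg// ?(le_trans asi) ?(le_trans sti).
Qed.

Definition variation_fun (R : realType) (a b : R) (f : R -> R) (x : R) : R :=
  fine (total_variation a (clamp a b x) f).

Section variation_fun.
Context {R : realType} (a b : R) (f : R -> R).
Hypotheses (ab : a <= b) (acf : abs_continuous a b f).

Let V := variation_fun a b f.

Lemma variation_funB s t : a <= s -> s <= t -> t <= b ->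
  (V t - V s)%:E = total_variation s t f.
Proof.
move=> sa st tb; have at' := le_trans sa st; have sb := le_trans st tb.
rewrite /V /variation_fun (clamp_id at' tb) (clamp_id sa sb).
have bv := abs_continuous_bounded_variation ab acf.
have fins : total_variation a s f \is a fin_num.
  apply/bounded_variationP => //.
  exact: (bounded_variationl sa (le_trans st tb) bv).
have fint : total_variation a t f \is a fin_num.
  apply/bounded_variationP; first exact: (le_trans sa st).
  exact: (bounded_variationl (le_trans sa st) tb bv).
by rewrite EFinB !fineK// (total_variationD f sa st) addeAC subee// add0e.
Qed.

Lemma variation_fun_clamp x : V (clamp a b x) = V x.
Proof. by rewrite /V /variation_fun clampK. Qed.

Lemma abs_continuous_variation_fun : abs_continuous a b V.
Proof.
move=> e e0; have e2 : 0 < e / 2 by rewrite divr_gt0.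
have [d d0 H] := abs_continuous_total_variation acf e2.
exists d => // n s t st tr l.
have := H n s t st tr l.
rewrite (eq_bigr (fun i => (V (t i) - V (s i))%:E)); last first.
  by move=> i _; have [? ? ?] := st i; rewrite variation_funB.
rewrite sumEFin lee_fin => Hl.
apply: (@le_lt_trans _ _ (e / 2)); last by rewrite ltr_pdivrMr// ltr_pMr// ltr1n.
rewrite (eq_bigr (fun i => V (t i) - V (s i)))// => i _.
have [? ? ?] := st i; rewrite ger0_norm// -lee_fin variation_funB//.
exact: total_variation_ge0.
Qed.

Lemma variation_fun_nondecreasing : nondecreasing V.
Proof.
move=> x y xy; rewrite -subr_ge0 -variation_fun_clamp -(variation_fun_clamp x).
rewrite -lee_fin variation_funB ?clamp_ge ?clamp_le ?clamp_homo//.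
exact/total_variation_ge0/clamp_homo.
Qed.

(** The two nondecreasing functions [V] and [V - f] are the Jordan decomposition
    of [f]. *)
Lemma variation_funB_nondecreasing : nondecreasing (fun x => V x - f (clamp a b x)).
Proof.
move=> x y xy; rewrite lerBrDr addrAC -addrA -lerBrDl.
apply: (le_trans (ler_norm _)).
rewrite -variation_fun_clamp -(variation_fun_clamp x).
rewrite -lee_fin variation_funB ?clamp_ge ?clamp_le ?clamp_homo//.
rewrite (le_trans _ (total_variation_ge f (clamp_homo a b xy)))//.
Qed.

End variation_fun.

(** * Stieltjes measures without singular part *)

Lemma lebesgue_stieltjes_oc (R : realType) (G : cumulative R R) (x y : R) :
  x <= y -> lebesgue_stieltjes_measure G `]x, y]%classic = (G y - G x)%:E.
Proof.
move=> xy; rewrite /lebesgue_stieltjes_measure/= /measure_extension.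
by rewrite measurable_mu_extE/= ?wlength_itv_bnd//; exact: is_ocitv.
Qed.

Section dyadic_cells.
Context {R : realType} (a b : R).
Hypothesis ab : a < b.

Definition dyadic_pt (n j : nat) : R := a + (b - a) * (j%:R / 2 ^+ n).

Definition dyadic_cell (n j : nat) : set R :=
  `]dyadic_pt n j, dyadic_pt n j.+1]%classic.

Lemma dyadic_pt_le n i j : (i <= j)%N -> dyadic_pt n i <= dyadic_pt n j.
Proof.
move=> ij; rewrite lerD2l; apply: ler_wpM2l; first by rewrite subr_ge0 ltW.
by apply: ler_wpM2r; rewrite ?invr_ge0 ?exprn_ge0// ler_nat.
Qed.

Lemma dyadic_pt0 n : dyadic_pt n 0 = a.
Proof. by rewrite /dyadic_pt mul0r mulr0 addr0. Qed.

Lemma dyadic_pt_end n : dyadic_pt n (2 ^ n) = b.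
Proof. by rewrite /dyadic_pt natrX divff ?expf_neq0// mulr1 addrC subrK. Qed.

Lemma dyadic_pt_double n j : dyadic_pt n.+1 j.*2 = dyadic_pt n j.
Proof.
by rewrite /dyadic_pt -muln2 natrM exprS; field; rewrite expf_neq0.
Qed.

Lemma dyadic_ptS n j : dyadic_pt n j.+1 - dyadic_pt n j = (b - a) / 2 ^+ n.
Proof. by rewrite /dyadic_pt -natr1; ring. Qed.

Lemma trivIset_dyadic_cell n D : trivIset D (dyadic_cell n).
Proof.
move=> i j _ _ [x []]; rewrite /dyadic_cell /= !in_itv/= => /andP[xi ix] /andP[xj jx].
case: (ltngtP i j) => // ij; exfalso.
  by have := dyadic_pt_le n ij; rewrite leNgt (lt_le_trans xj ix).
by have := dyadic_pt_le n ij; rewrite leNgt (lt_le_trans xi jx).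
Qed.

(** The cells of level [n] inside an open set are disjoint by construction and
    exhaust it as [n] grows; they replace its decomposition into components. *)
Definition dyadic_inner (U : set R) (n j : nat) : set R :=
  if `[< dyadic_cell n j `<=` U >] then dyadic_cell n j else set0.

Lemma dyadic_inner_homo U : {homo (fun n => \bigcup_(j < 2 ^ n) dyadic_inner U n j) :
  n m / (n <= m)%N >-> n `<=` m}.
Proof.
apply: homo_leq => [A//|B A C AB BC|n]; first exact: subset_trans AB BC.
move=> x [j /= jn]; rewrite /dyadic_inner; case: asboolP => // cU xc.
have sub k : (k = j.*2 \/ k = j.*2.+1)%N -> dyadic_cell n.+1 k `<=` dyadic_cell n j.
  move=> kj y; rewrite /dyadic_cell /= !in_itv/= => /andP[ky yk].
  rewrite -!(dyadic_pt_double n) (le_lt_trans _ ky) ?(le_trans yk)//.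
  - by apply: dyadic_pt_le; case: kj => ->; lia.
  - by apply: dyadic_pt_le; case: kj => ->; lia.
have [xm|mx] := leP x (dyadic_pt n.+1 j.*2.+1).
  exists j.*2 => /=; first by rewrite expnS; lia.
  case: asboolP => [_|]; last by case; apply: subset_trans cU; apply: sub; left.
  rewrite /dyadic_cell /= in_itv/= xm andbT dyadic_pt_double.
  by move: xc; rewrite /dyadic_cell/= in_itv/= => /andP[].
exists j.*2.+1 => /=; first by rewrite expnS; lia.
case: asboolP => [_|]; last by case; apply: subset_trans cU; apply: sub; right.
rewrite /dyadic_cell /= in_itv/= mx /= -doubleS dyadic_pt_double.
by move: xc; rewrite /dyadic_cell/= in_itv/= => /andP[].
Qed.

Lemma dyadic_cell_cover n x : a < x -> x <= b ->
  exists2 j, (j < 2 ^ n)%N & dyadic_cell n j x.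
Proof.
move=> ax xb.
have ex : exists k, x <= dyadic_pt n k by exists (2 ^ n)%N; rewrite dyadic_pt_end.
case: (ex_minnP ex) => -[|j]; first by rewrite dyadic_pt0 leNgt ax.
move=> xj minj; exists j; first by apply: minj; rewrite dyadic_pt_end.
rewrite /dyadic_cell/= in_itv/= xj andbT ltNge; apply/negP => /minj.
by rewrite ltnn.
Qed.

Lemma dyadic_inner_cover U : open U -> `]a, b]%classic `&` U `<=`
  \bigcup_n \bigcup_(j < 2 ^ n) dyadic_inner U n j.
Proof.
move=> oU x [] /=; rewrite in_itv/= => /andP[ax xb] Ux.
have /nbhs_ballP[r /= r0 rU] : nbhs x U by exact: open_nbhs_nbhs.
pose N := Num.truncn ((b - a) / r).
have Nr : (b - a) / 2 ^+ N < r.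
  rewrite ltr_pdivrMr ?exprn_gt0// -ltr_pdivrMl// mulrC.
  rewrite (lt_le_trans (truncnS_gt _))// -/N -natrX ler_nat.
  exact: ltn_expl.
have [j jN xj] := dyadic_cell_cover N ax xb.
exists N => //; exists j => //.
rewrite /dyadic_inner; case: asboolP => //; case=> y yc; apply: rU.
move: xj yc; rewrite /dyadic_cell /= !in_itv/= => /andP[jx xj] /andP[jy yj].
have := dyadic_ptS N j; move: Nr; set h := (b - a) / _ => hr hE.
by rewrite /ball/= ltr_norml; apply/andP; split; lra.
Qed.

Lemma dyadic_inner_sub U n : \bigcup_(j < 2 ^ n) dyadic_inner U n j `<=` U.
Proof.
by move=> x [j /= _]; rewrite /dyadic_inner; case: asboolP => // + xc; apply.
Qed.

Lemma measurable_dyadic_inner U n j : measurable (dyadic_inner U n j).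
Proof. by rewrite /dyadic_inner /dyadic_cell; case: ifP => _; [exact: measurable_itv|exact: measurable0]. Qed.

End dyadic_cells.

(** A null set lies in an open set of small Lebesgue measure. The dyadic cells
    inside it form short disjoint families, on which an absolutely continuous
    function has small increments; continuity from below passes to the open
    set. *)
Lemma lebesgue_stieltjes_null (R : realType) (a b : R) (G : cumulative R R)
    (A : set R) :
  a < b -> abs_continuous a b G -> measurable A -> A `<=` `]a, b]%classic ->
  lebesgue_measure A = 0%E -> lebesgue_stieltjes_measure G A = 0%E.
Proof.
move=> ab acG mA Aab A0; set nu := lebesgue_stieltjes_measure G.
apply/eqP; rewrite eq_le measure_ge0 andbT; apply/lee_addgt0Pr => e e0.
rewrite add0e; have [d d0 H] := acG e e0.
have Afin : (lebesgue_measure A < +oo)%E by rewrite A0 ltry.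
have [U [oU AU UAd]] := lebesgue_regularity_outer mA Afin d0.
have mU : measurable U by exact: measurable_realfun.open_measurable.
have Ud : (lebesgue_measure U < d%:E)%E.
  rewrite (_ : U = (U `\` A) `|` A); last by rewrite setUC setDUK.
  apply: le_lt_trans UAd; rewrite -[leRHS]adde0 -[in leRHS]A0.
  by apply: measureU2 => //; exact: measurableD.
pose W n := \bigcup_(j < 2 ^ n) dyadic_inner a b U n j.
have mW n : measurable (W n).
  by apply: bigcup_measurable => j _; exact: measurable_dyadic_inner.
have WE n (mu : {measure set (measurableTypeR R) -> \bar R}) :
    mu (W n) = (\sum_(j < 2 ^ n) mu (dyadic_inner a b U n j))%E.
  rewrite /W bigcup_mkord measure_semi_additive_ord_I//.
  - by move=> k _; exact: measurable_dyadic_inner.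
  - move=> i j _ _ [x []]; rewrite /dyadic_inner.
    case: ifP => // _ xi; case: ifP => // _ xj.
    by apply: (@trivIset_dyadic_cell _ a b ab n setT) => //; exists x.
  - by apply: bigsetU_measurable => k _; exact: measurable_dyadic_inner.
have nuW n : (nu (W n) <= e%:E)%E.
  pose s (j : 'I_(2 ^ n)) := dyadic_pt a b n j.
  (* the cells that are not inside [U] are collapsed to empty intervals *)
  pose t (j : 'I_(2 ^ n)) := if `[< dyadic_cell a b n j `<=` U >]
    then dyadic_pt a b n j.+1 else s j.
  have st j : s j <= t j by rewrite /t; case: ifP => // _; exact: dyadic_pt_le.
  have innerE (j : 'I_(2 ^ n)) : dyadic_inner a b U n j = `]s j, t j]%classic.
    by rewrite /dyadic_inner /t; case: ifP => // _; rewrite set_itv_ge// bnd_simp ltxx.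
  have bnd j : [/\ a <= s j, s j <= t j & t j <= b].
    split => //.
    - by rewrite -[leLHS](@dyadic_pt0 _ a b n); exact: dyadic_pt_le.
    - rewrite -[leRHS](@dyadic_pt_end _ a b n) /t; case: ifP => // _.
        exact: dyadic_pt_le.
      by apply: dyadic_pt_le => //; exact/ltnW.
  have triv : trivIset setT (fun j => `]s j, t j[%classic).
    move=> i j _ _ [x [xi xj]]; apply: val_inj.
    apply: (@trivIset_dyadic_cell _ a b ab n setT) => //.
    have oo (k : 'I_(2 ^ n)) : `]s k, t k[%classic x -> dyadic_cell a b n k x.
      rewrite /dyadic_cell /= !in_itv/= => /andP[-> xt]/=.
      rewrite (le_trans (ltW xt))// /t; case: ifP => // _.
      exact: dyadic_pt_le.
    by exists x; split; apply: oo.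
  have len : \sum_j (t j - s j) < d.
    rewrite -lte_fin; apply: le_lt_trans Ud.
    apply: (@le_trans _ _ (lebesgue_measure (W n))).
      rewrite WE -sumEFin; apply: lee_sum => j _.
      rewrite innerE le_eqVlt; apply/orP; left; apply/eqP/esym.
      exact: (lebesgue_stieltjes_oc idfun (st j)).
    apply: le_measure; rewrite ?inE//; first exact: mW.
    exact: (@dyadic_inner_sub _ a b U n).
  have := H _ s t bnd triv len => Hs.
  rewrite [leLHS](WE n (lebesgue_stieltjes_measure G)).
  rewrite (eq_bigr (fun j => (G (t j) - G (s j))%:E)); last first.
    by move=> j _; rewrite innerE; exact: lebesgue_stieltjes_oc.
  rewrite sumEFin lee_fin (le_trans _ (ltW Hs))//; apply: ler_sum => j _.
  exact: ler_norm.
have mUW : measurable (\bigcup_n W n) by exact: bigcup_measurable.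
apply: (@le_trans _ _ (nu (\bigcup_n W n))).
  apply: le_measure; rewrite ?inE; [exact: mA|exact: mUW|].
  move=> x Ax.
  have : (`]a, b]%classic `&` U) x by split; [exact: Aab|exact: AU].
  exact: dyadic_inner_cover.
have nd : {homo W : n m / (n <= m)%N >-> (n <= m)%O}.
  by move=> n m nm; apply/subsetPset/(dyadic_inner_homo ab).
have cv : nu (W n) @[n --> \oo] --> nu (\bigcup_n W n).
  exact: (@nondecreasing_cvg_mu _ _ _ (lebesgue_stieltjes_measure G)).
rewrite -(cvg_lim _ cv)//; apply: lime_le; last exact: nearW.
by apply/cvg_ex; eexists; exact: cv.
Qed.

(** * Almost everywhere differentiability of absolutely continuous functions *)

Lemma nondecreasing_abs_continuous_integral (R : realType) (a b : R)
    (G : R -> R) : a < b -> nondecreasing G -> continuous G ->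
  abs_continuous a b G ->
  exists h : R -> R,
    (@lebesgue_measure R).-integrable [set: R] (EFin \o h) /\
    forall x, a <= x -> x <= b ->
      G x - G a = \int[lebesgue_measure]_(t in `]a, x]) h t.
Proof.
move=> ab ndG cG acG.
pose Gc : cumulative R R :=
  HB.pack G (isCumulative.Build R _ R G ndG (right_continuousW cG)).
have mab : measurable (`]a, b]%classic : set (measurableTypeR R)) by [].
have fin_ab : (lebesgue_stieltjes_measure Gc `]a, b]%classic < +oo)%E.
  by rewrite (@lebesgue_stieltjes_oc _ Gc) ?ltry// ltW.
pose nu : {finite_measure set (measurableTypeR R) -> \bar R} :=
  mfrestr mab fin_ab.
have nu_leb : nu `<< (@lebesgue_measure R).
  apply/null_content_dominatesP => A mA A0.
  apply: (@lebesgue_stieltjes_null _ a b Gc) => //.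
  - exact: measurableI.
  - apply/eqP; rewrite eq_le measure_ge0 andbT -A0.
    by apply: le_measure; rewrite ?inE//; exact: measurableI.
have [h [h0 hfin inth hE]] := radon_nikodym_sigma_finite nu_leb.
have hK : EFin \o (fine \o h) = h by apply/funext => x /=; rewrite fineK.
exists (fine \o h); rewrite hK; split=> // x ax xb.
rewrite /Rintegral -[X in fine X]/(integral _ _ (EFin \o (fine \o h))) hK.
rewrite -hE//.
suff -> : nu `]a, x]%classic = (G x - G a)%:E by [].
rewrite /nu/= /mfrestr/= /mrestr (_ : _ `&` _ = `]a, x]%classic).
  exact: (@lebesgue_stieltjes_oc _ Gc).
apply/setIidl => y /=; rewrite !in_itv/= => /andP[-> /le_trans]; exact.
Qed.

(** The density of [f] is the difference of the densities of the two parts of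
    its Jordan decomposition. *)
Lemma abs_continuous_integral (R : realType) (a b : R) (f : R -> R) :
  a < b -> abs_continuous a b f ->
  exists h : R -> R,
    (@lebesgue_measure R).-integrable [set: R] (EFin \o h) /\
    forall x, a <= x -> x <= b ->
      f x - f a = \int[lebesgue_measure]_(t in `]a, x]) h t.
Proof.
move=> ab acf; have leab := ltW ab.
pose V := variation_fun a b f.
pose W x := V x - f (clamp a b x).
have acV : abs_continuous a b V by exact: abs_continuous_variation_fun.
have acW : abs_continuous a b W.
  apply: abs_continuousB => //; apply: eq_abs_continuous acf => x ax xb.
  by rewrite clamp_id.
have Vc x : V (clamp a b x) = V x by exact: variation_fun_clamp.
have Wc x : W (clamp a b x) = W x by rewrite /W Vc clampK.
have [|h1 [ih1 Eh1]] := nondecreasing_abs_continuous_integral ab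
  (variation_fun_nondecreasing leab acf) _ acV.
  exact: abs_continuous_clamp_continuous acV Vc.
have [|h2 [ih2 Eh2]] := nondecreasing_abs_continuous_integral ab
  (variation_funB_nondecreasing leab acf) _ acW.
  exact: abs_continuous_clamp_continuous acW Wc.
exists (h1 \- h2); split.
  rewrite (_ : _ \o _ = (EFin \o h1) \- (EFin \o h2))%E; last exact/funext.
  exact: integrableB.
move=> x ax xb; rewrite RintegralB//; last 2 first.
- exact: integrableS ih1.
- exact: integrableS ih2.
have E2 := Eh2 x ax xb.
by rewrite -Eh1// -E2 !clamp_id//; rewrite /V; ring.
Qed.

Lemma abs_continuous_derivable_ae (R : realType) (a b : R) (f : R -> R) :
  a < b -> abs_continuous a b f ->
  exists h : R -> R,
    [/\ (@lebesgue_measure R).-integrable [set: R] (EFin \o h),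
        f b - f a = \int[lebesgue_measure]_(t in `]a, b]) h t
      & {ae lebesgue_measure, forall x, a < x -> x < b ->
           derivable f x 1 /\ derive1 f x = h x} ].
Proof.
move=> ab acf; have [h [ih Eh]] := abs_continuous_integral ab acf.
exists h; split => //; first by rewrite Eh// ltW.
have loch : locally_integrable [set: R] h.
  by have := integrable_locally measurableT ih; rewrite patch_setT.
have iy y : (@lebesgue_measure R).-integrable
    [set` Interval (BRight a) (BRight y)] (EFin \o h) by exact: integrableS ih.
have := FTC1 iy loch.
apply: filterS; first exact: (ae_filter_ringOfSetsType (@lebesgue_measure R)).
move=> x /= + ax xb.
move=> /(_ ax) [dF FE].
set F := (X in derivable X x 1) in dF FE.
have fF : {near x, f =1 cst (f a) \+ F}.
  near=> y; rewrite /F/= /cst -Eh ?subrKC//; apply/ltW.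
  + by near: y; exact: lt_nbhsr.
  + by near: y; exact: lt_nbhsl.
have Fx : is_derive x 1 F (h x) by rewrite -FE derive1E; exact/derivableP.
have [df fE] : is_derive x 1 f (h x).
  apply: (@near_eq_is_derive _ _ _ (cst (f a) \+ F)); first by near do apply/esym.
  by rewrite -[h x]add0r; exact: is_deriveD.
by split=> //; rewrite derive1E.
Unshelve. all: by end_near. Qed.

(** * Mean value properties *)

(** The hypothesis bears on the total derivative, which says nothing at points
    where [f] has no derivative; that these form a null set is what makes the
    inequality true. *)
Lemma abs_continuous_mean_value (R : realType) (a b : R) (f : R -> R) (M : R) :
  a <= b -> 0 <= M -> abs_continuous a b f ->
  {ae lebesgue_measure, forall x, a < x -> x < b -> `|derive1 f x| <= M} ->
  `|f b - f a| <= M * (b - a).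
Proof.
rewrite le_eqVlt => /predU1P[-> *|ab M0 acf dM].
  by rewrite !subrr normr0 mulr0.
have [h [ih -> dfh]] := abs_continuous_derivable_ae ab acf.
have ihab : (@lebesgue_measure R).-integrable `]a, b] (EFin \o h).
  exact: integrableS ih.
apply: le_trans (le_normr_Rintegral _ ihab) _ => //.
have bN : {ae (@lebesgue_measure R), forall x, x != b}.
  exists [set b]; split => //; first exact: lebesgue_measure_set1.
  by move=> x /= /negP; rewrite negbK => /eqP.
have : (\int[lebesgue_measure]_(x in `]a, b]) `|h x|%:E <=
    \int[lebesgue_measure]_(x in `]a, b]) (cst M%:E x))%E.
  apply: ae_ge0_le_integral => //.
    apply/measurable_EFinP/measurableT_comp => //.
    by apply/measurable_EFinP; exact: measurable_int ihab.
  apply: filterS3 bN dfh dM; first exact: (ae_filter_ringOfSetsType (@lebesgue_measure R)).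
  move=> x /= xb dfx dMx; rewrite in_itv/= => /andP[ax xb'].
  have {}xb : x < b by rewrite lt_neqAle xb.
  by have [_ <-] := dfx ax xb; rewrite lee_fin dMx.
have -> : (\int[lebesgue_measure]_(x in `]a, b]) (cst M%:E x) =
    (M * (b - a))%:E)%E.
  rewrite integral_cst// EFinM; congr (_ * _)%E.
  by rewrite [LHS](lebesgue_measure_itv `]a, b])/= lte_fin ab.
move=> hM.
rewrite -lee_fin /Rintegral fineK// fin_numE -ltNye -ltey.
rewrite (le_lt_trans hM) ?ltry// andbT.
by apply: (@lt_le_trans _ _ 0%E); rewrite ?ltNyr// integral_ge0.
Qed.

Lemma loc_abs_continuous_continuous (R : realType) (f : R -> R) :
  loc_abs_continuous f -> continuous f.
Proof.
move=> acf x; have le2 : x - 1 <= x + 1 by lra.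
apply/cvgrPdist_lt => e e0; have [d d0 H] := acf _ _ le2 e e0.
have {}H s t : x - 1 <= s -> t <= x + 1 -> s <= t -> t - s < d -> `|f t - f s| < e.
  move=> xs tx st std.
  have := H 1%N (fun=> s) (fun=> t) (fun=> And3 xs st tx) (@trivIset_ord1 _ _).
  by rewrite !big_ord_recl !big_ord0 !addr0; apply.
near=> y.
have xyd : `|x - y| < d by near: y; apply/nbhs_ballP; exists d => /=.
have xy1 : `|x - y| < 1 by near: y; apply/nbhs_ballP; exists 1 => /=.
have [? ?] := ltr_normlP _ _ xyd; have [? ?] := ltr_normlP _ _ xy1.
have lo : x - 1 <= x by lra.
have hi : x <= x + 1 by lra.
have lo' : x - 1 <= y by lra.
have hi' : y <= x + 1 by lra.
have [xy|yx] := leP x y; first by rewrite distrC; apply: H => //; lra.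
by apply: H => //; lra.
Unshelve. all: end_near. Qed.

(** Where the difference quotients do not converge, the total derivative is
    zero. *)
Lemma derivable_derive1_neq0 (R : realType) (f : R -> R) (x : R) :
  derive1 f x != 0 -> derivable f x 1.
Proof.
rewrite derive1E => H; apply/not_notP => nd; move/eqP: H; apply.
by rewrite /derive dvgP.
Qed.

(** If the total derivative were larger than [D] everywhere, it would vanish
    nowhere; so [f] would be differentiable and the usual mean value theorem
    would contradict the bound on the increment. *)
Lemma exists_derive1_le (R : realType) (f : R -> R) (a b D : R) :
  a < b -> continuous f -> 0 <= D -> `|f b - f a| <= D * (b - a) ->
  exists x, [/\ a <= x, x <= b & `|derive1 f x| <= D].
Proof.
move=> ab cf D0 fab; apply/not_existsP => H.
have big x : a <= x -> x <= b -> D < `|derive1 f x|.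
  by move=> ax xb; rewrite ltNge; apply/negP => dx; exact: (H x).
have df x : x \in `]a, b[ -> is_derive x 1 f (derive1 f x).
  rewrite in_itv/= => /andP[/ltW ax /ltW xb]; rewrite derive1E.
  apply/derivableP/derivable_derive1_neq0.
  by rewrite -normr_gt0 (le_lt_trans D0)// big.
have [|c + E] := MVT ab df; first exact: continuous_subspaceT.
rewrite in_itv/= => /andP[/ltW ac /ltW cb]; move: fab.
rewrite E normrM (@ger0_norm _ (b - a)); last by rewrite subr_ge0 ltW.
by rewrite ler_pM2r ?subr_gt0// leNgt big.
Qed.

Lemma continuous_integrable_itv (R : realType) (y : R -> R) (a b : R) :
  continuous y -> (@lebesgue_measure R).-integrable `[a, b] (EFin \o y).
Proof.
move=> cy; apply: continuous_compact_integrable; first exact: segment_compact.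
exact: continuous_subspaceT.
Qed.

Lemma Rintegral_itv_cst (R : realType) (a b c : R) : a <= b ->
  \int[lebesgue_measure]_(x in `[a, b]) c = c * (b - a).
Proof.
move=> ab; rewrite Rintegral_cst// [X in fine X](lebesgue_measure_itv `[a, b])/= lte_fin.
by case: ltP => //= ba; rewrite (_ : a = b) ?subrr//; apply/eqP; rewrite eq_le ab.
Qed.

(** The extreme values of [y] enclose its mean; if neither is small then they
    have opposite signs and [y] vanishes in between. *)
Lemma exists_le_mean (R : realType) (y : R -> R) (p h A : R) :
  continuous y -> 0 < h -> 0 <= A ->
  `|\int[lebesgue_measure]_(x in `[p, p + h]) y x| <= A ->
  exists x, [/\ p <= x, x <= p + h & `|y x| <= A / h].
Proof.
move=> cy h0 A0 yA; have ph : p <= p + h by rewrite lerDl ltW.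
have iy := continuous_integrable_itv p (p + h) cy.
have ic c : (@lebesgue_measure R).-integrable `[p, p + h] (EFin \o cst c).
  by apply: continuous_integrable_itv => x; exact: cvg_cst.
have cyw : {within `[p, p + h], continuous y} by exact: continuous_subspaceT.
have [M Mp Mmax] := EVT_max ph cyw.
have [m mp mmin] := EVT_min ph cyw.
have intM : \int[lebesgue_measure]_(x in `[p, p + h]) y x <= y M * h.
  rewrite (_ : y M * h = \int[lebesgue_measure]_(x in `[p, p + h]) (cst (y M) x)).
    by apply: le_Rintegral => //; exact: ic.
  by rewrite Rintegral_itv_cst// addrC addKr.
have intm : y m * h <= \int[lebesgue_measure]_(x in `[p, p + h]) y x.
  rewrite (_ : y m * h = \int[lebesgue_measure]_(x in `[p, p + h]) (cst (y m) x)).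
    by apply: le_Rintegral => //; exact: ic.
  by rewrite Rintegral_itv_cst// addrC addKr.
move: yA; rewrite ler_norml => /andP[yA1 yA2].
have ym : y m <= A / h by rewrite ler_pdivlMr// (le_trans intm).
have yM : - (A / h) <= y M.
  by rewrite -mulNr ler_pdivrMr// (le_trans _ intM).
have inP z : z \in `[p, p + h] -> p <= z /\ z <= p + h.
  by rewrite in_itv/= => /andP[].
have [Msmall|Mbig] := leP (y M) (A / h).
  by exists M; have [? ?] := inP _ Mp; split => //; rewrite ler_norml yM.
have [msmall|mbig] := leP (- (A / h)) (y m).
  by exists m; have [? ?] := inP _ mp; split => //; rewrite ler_norml msmall.
have Ah : 0 <= A / h by rewrite divr_ge0// ltW.
(* both extrema are large, of opposite signs *)
have [z zmM z0] : exists2 z, z \in `[p, p + h] & y z = 0.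
  have [mM|Mm] := leP m M.
    have [|z zp z0] := @IVT _ y m M 0 mM (continuous_subspaceT cy).
      by move: mbig Mbig Ah; clear; move=> mb Mb Ah; rewrite /Num.min /Num.max; case: ltP => *; apply/andP; split; lra.
    exists z => //; move: zp (inP _ Mp) (inP _ mp); rewrite !in_itv/=.
    by clear; move=> /andP[? ?] [? ?] [? ?]; apply/andP; split; lra.
  have [|z zp z0] := @IVT _ y M m 0 (ltW Mm) (continuous_subspaceT cy).
    by move: mbig Mbig Ah; clear; move=> mb Mb Ah; rewrite /Num.min /Num.max; case: ltP => *; apply/andP; split; lra.
  exists z => //; move: zp (inP _ Mp) (inP _ mp); rewrite !in_itv/=.
  by clear; move=> /andP[? ?] [? ?] [? ?]; apply/andP; split; lra.
by exists z; have [? ?] := inP _ zmM; split => //; rewrite z0 normr0.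
Qed.

(** * Local and global bounds on solutions *)

Lemma continuous_normr_bound (R : realType) (y : R -> R) (a b : R) :
  a <= b -> continuous y ->
  exists2 S, (forall x, a <= x -> x <= b -> `|y x| <= S) &
    exists x, [/\ a <= x, x <= b & `|y x| = S].
Proof.
move=> ab cy.
have cn : continuous (fun x => `|y x|).
  by move=> x; apply: (continuous_comp (cy x)); exact: norm_continuous.
have [M Mp Mmax] := EVT_max ab (continuous_subspaceT cn).
exists `|y M| => [x ax xb|]; first by apply: Mmax; rewrite in_itv/= ax.
by exists M; move: Mp; rewrite in_itv/= => /andP[].
Qed.

(** Since [y' = z + b y] holds everywhere for the total derivative, by the very
    definition of the quasi-derivative [z], continuity of [z] gives that of
    [y']. *)
Lemma solution_continuous (R : realType) (b : R -> R) (l : R) (y : R -> R) :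
  continuous b -> solution b l y ->
  continuous y /\ continuous (derive1 y).
Proof.
move=> cb [/loc_abs_continuous_continuous cy /loc_abs_continuous_continuous cz _].
split=> //; rewrite (_ : derive1 y = (fun x => quasi_deriv b y x + b x * y x)).
  move=> x; apply: cvgD; first exact: cz.
  by apply: cvgM; [exact: cb|exact: cy].
by apply/funext => x; rewrite /quasi_deriv subrK.
Qed.

(** The maxima [S] of [|y|] and [G] of [|y'|] over the interval bound each other:
    [S <= A/h + 3h G] since [y] is small somewhere, and
    [G <= 2A/h^2 + 3h (|l| S + beta G) + 2 beta S] since [y'] is small somewhere
    and [y' = z + b y] with [z' = - l y - b y']. When the interval is short,
    eliminating [G] leaves [S] on the right with a coefficient below one. *)
Lemma solution_local_bound (R : realType) (b : R -> R) (l : R) (y : R -> R)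
    (p h beta A : R) :
  continuous b -> solution b l y -> 0 < h -> 0 <= A ->
  (forall x, p <= x -> x <= p + 3 * h -> `|b x| <= beta) ->
  3 * h <= 8^-1 -> 3 * h * beta <= 16^-1 -> 3 * h * `|l| <= 4^-1 ->
  `|\int[lebesgue_measure]_(x in `[p, p + h]) y x| <= A ->
  `|\int[lebesgue_measure]_(x in `[p + 2 * h, p + 2 * h + h]) y x| <= A ->
  forall x, p <= x -> x <= p + 3 * h -> `|y x| <= 18 * (A / h).
Proof.
move=> cb sol h0 A0 bb hd hb hl int1 int2.
have [cy cg] := solution_continuous cb sol.
have [acy acz tauy] := sol.
have [x0 [px0 x0h y0]] := exists_le_mean cy h0 A0 int1.
have [x1 [px1 x1h y1]] := exists_le_mean cy h0 A0 int2.
set Ah := A / h in y0 y1 *.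
have Ah0 : 0 <= Ah by rewrite divr_ge0// ltW.
(* [y] varies by at most [2 Ah] between two points at distance at least [h] *)
pose D := 2 * Ah / h.
have Dh : D * h = 2 * Ah by rewrite /D divfK ?gt_eqF.
have D0 : 0 <= D by apply: divr_ge0; [exact: mulr_ge0|exact: ltW].
have x01 : x0 < x1 by move: h0 x0h px1; clear; lra.
have yx01 : `|y x1 - y x0| <= D * (x1 - x0).
  apply: (le_trans (ler_normB _ _)).
  have : D * h <= D * (x1 - x0) by rewrite ler_wpM2l//; move: x0h px1; clear; lra.
  by move: y0 y1; rewrite Dh; clear; lra.
have [xi [x0xi xix1 gxi]] := exists_derive1_le x01 cy D0 yx01.
have pq : p <= p + 3 * h by move: h0; clear; lra.
have [S yS [s [ps sq Ss]]] := continuous_normr_bound pq cy.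
have [G gG [u [pu uq Gu]]] := continuous_normr_bound pq cg.
have S0 : 0 <= S by rewrite -Ss.
have G0 : 0 <= G by rewrite -Gu.
have beta0 : 0 <= beta by apply: le_trans (bb _ (lexx p) pq).
have M0 : 0 <= `|l| * S + beta * G by rewrite addr_ge0// mulr_ge0.
have lipy a c : p <= a -> a <= c -> c <= p + 3 * h -> `|y c - y a| <= G * (c - a).
  move=> pa ac cq; apply: abs_continuous_mean_value => //; first exact: acy.
  by apply: aeW => x ax xc; apply: gG; [exact: le_trans (ltW ax)|exact: le_trans (ltW xc) cq].
have lipz a c : p <= a -> a <= c -> c <= p + 3 * h ->
    `|quasi_deriv b y c - quasi_deriv b y a| <= (`|l| * S + beta * G) * (c - a).
  move=> pa ac cq; apply: abs_continuous_mean_value => //; first exact: acz.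
  apply: filterS tauy; first exact: (ae_filter_ringOfSetsType (@lebesgue_measure R)).
  move=> x tx ax xc; have {tx} := tx I; rewrite /tau => tx.
  have px : p <= x by exact: le_trans (ltW ax).
  have xq : x <= p + 3 * h by exact: le_trans (ltW xc) cq.
  have -> : derive1 (quasi_deriv b y) x = - (l * y x) - b x * derive1 y x by rewrite -tx; ring.
  rewrite (le_trans (ler_normB _ _))// normrN !normrM.
  by apply: lerD; apply: ler_pM => //; [exact: yS|exact: bb|exact: gG].
have absd a c : p <= a -> a <= p + 3 * h -> p <= c -> c <= p + 3 * h ->
    forall (f : R -> R) M, 0 <= M ->
    (forall a c, p <= a -> a <= c -> c <= p + 3 * h -> `|f c - f a| <= M * (c - a)) ->
    `|f c - f a| <= M * (3 * h).
  move=> pa aq pc cq f M M1 H; have [ac|/ltW ca] := leP a c.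
    apply: (le_trans (H _ _ pa ac cq)); apply: ler_wpM2l => //.
    by move: pa cq; clear; lra.
  rewrite distrC; apply: (le_trans (H _ _ pc ca aq)); apply: ler_wpM2l => //.
  by move: pc aq; clear; lra.
have Sbound : S <= Ah + G * (3 * h).
  have x0q : x0 <= p + 3 * h by move: h0 x0h; clear; lra.
  have := absd x0 s px0 x0q ps sq y G G0 lipy.
  by rewrite -Ss; have := ler_normD (y s - y x0) (y x0); rewrite subrK; move: y0; clear; lra.
have xip : p <= xi by exact: le_trans px0 x0xi.
have xiq : xi <= p + 3 * h by move: x1h xix1; clear; lra.
have Gbound : G <= D + (`|l| * S + beta * G) * (3 * h) + 2 * (beta * S).
  have := absd xi u xip xiq pu uq _ _ M0 lipz.
  set dz := quasi_deriv b y u - quasi_deriv b y xi => Hdz.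
  have E : derive1 y u = dz + derive1 y xi + (b u * y u - b xi * y xi).
    by rewrite /dz /quasi_deriv; ring.
  rewrite -[leLHS]Gu [in leLHS]E (le_trans (ler_normD _ _))//.
  have := ler_normD dz (derive1 y xi).
  have := ler_normB (b u * y u) (b xi * y xi).
  rewrite !normrM.
  have : `|b u| * `|y u| <= beta * S by apply: ler_pM => //; [exact: bb|exact: yS].
  have : `|b xi| * `|y xi| <= beta * S by apply: ler_pM => //; [exact: bb|exact: yS].
  by move: gxi Hdz; clear; lra.
suff : S <= 18 * Ah by move=> Sle x px xq; apply: le_trans Sle; exact: yS.
have e1 : `|l| * (3 * h) * S <= 4^-1 * S by apply: ler_wpM2r => //; move: hl; clear; lra.
have e2 : 3 * h * beta * G <= 16^-1 * G by apply: ler_wpM2r.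
(* absorb the terms in [G], then those in [S], using the smallness of [3h] *)
have G1 : G <= 16 / 15 * (D + (4^-1 + 2 * beta) * S).
  by move: Gbound e1 e2; clear; lra.
have e3 : 3 * h * G <= 3 * h * (16 / 15 * (D + (4^-1 + 2 * beta) * S)).
  by apply: ler_wpM2l => //; move: h0; clear; lra.
have e4 : 3 * h * beta * S <= 16^-1 * S by apply: ler_wpM2r.
have e5 : 3 * h * S <= 8^-1 * S by apply: ler_wpM2r.
by move: Sbound e3 e4 e5 Dh S0; clear; lra.
Qed.

(** The n-th grid has mesh [1/n] and starts at [-n], so that [2 n^2] cells cover
    [[-n, n]] and both half-lines are treated together. *)
Definition grid_pt (R : realType) (m j : nat) : R := j%:R / m%:R - m%:R.

Definition grid_right (R : realType) (m j : nat) : R := grid_pt R m j + m%:R^-1.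

(** At a point [x] the grid is chosen as fine as the local bound requires, that
    is with mesh of order [1/(1 + |x|)] since [b] grows linearly. *)
Lemma solution_poly_growth (R : realType) (b : R -> R) (l : R) (y : R -> R)
    (C D : R) (q : nat) :
  continuous b -> solution b l y -> 0 <= C -> 0 <= D ->
  (forall t, `|b t| <= C * (1 + `|t|)) ->
  (forall m j, (0 < m)%N -> (j < 2 * m ^ 2)%N ->
    `|\int[lebesgue_measure]_(x in `[grid_pt R m j, grid_right R m j]) y x|
      <= D * m%:R ^+ q) ->
  exists2 C' : R, 0 <= C' & forall x, `|y x| <= C' * (1 + `|x|) ^+ q.+1.
Proof.
move=> cb sol C0 D0 bC intD.
(* the three summands serve the three smallness conditions of the local bound *)
pose K := 24 + 96 * C + 12 * `|l|.
have K24 : 24 <= K by rewrite /K -addrA lerDl addr_ge0 ?mulr_ge0.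
exists (18 * D * (K + 1) ^+ q.+1).
  by rewrite mulr_ge0 ?mulr_ge0// exprn_ge0//; lra.
move=> x; pose m := (Num.truncn (K * (1 + `|x|))).+1.
have x0 : 0 <= `|x| by [].
have Kx0 : 0 <= K * (1 + `|x|) by rewrite mulr_ge0//; lra.
have mK : K * (1 + `|x|) < m%:R by exact: truncnS_gt.
have Km : m%:R <= (K + 1) * (1 + `|x|).
  have : (Num.truncn (K * (1 + `|x|)))%:R <= K * (1 + `|x|) by rewrite truncn_le.
  by rewrite /m -natr1; lra.
have mx : `|x| + 24 < m%:R.
  have : 24 * (1 + `|x|) <= K * (1 + `|x|) by apply: ler_wpM2r => //; move: x0; clear; lra.
  by move: mK x0; clear; lra.
have m0 : (0 : R) < m%:R by rewrite ltr0n.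
set h := (m%:R : R)^-1.
have h0 : 0 < h by rewrite invr_gt0.
have hm : h * m%:R = 1 by rewrite mulVf// gt_eqF.
have [xlo xhi] : - x <= `|x| /\ x <= `|x| by rewrite -{1}normrN !ler_norm.
have xm0 : 0 <= (x + m%:R) * m%:R by rewrite mulr_ge0// ltW; move: mx xlo; clear; lra.
(* the index of the cell that contains [x] *)
pose j := Num.truncn ((x + m%:R) * m%:R).
have jle : j%:R <= (x + m%:R) * m%:R by rewrite truncn_le.
have jgt : (x + m%:R) * m%:R < j%:R + 1 by rewrite natr1; exact: truncnS_gt.
have ptx : grid_pt R m j <= x.
  rewrite /grid_pt lerBlDr ler_pdivrMr//.
have xpt : x <= grid_pt R m j + h.
  rewrite /grid_pt addrAC lerBrDr.
  have -> : j%:R / m%:R + h = (j%:R + 1) / m%:R by rewrite mulrDl mul1r.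
  by rewrite ler_pdivlMr// ltW.
have jm : (j.+2 < 2 * m ^ 2)%N.
  rewrite -(ltr_nat R) natrM natrX -natr1 -natr1.
  have : (x + m%:R) * m%:R <= (m%:R - 24 + m%:R) * m%:R :> R.
    by apply: ler_wpM2r; [exact: ltW|move: mx xhi; clear; lra].
  by move: jle m0 mx x0; clear; nra.
have pt2 : grid_pt R m j.+2 = grid_pt R m j + 2 * h.
  by rewrite /grid_pt -natr1 -natr1 /h; ring.
have A0 : 0 <= D * m%:R ^+ q by rewrite mulr_ge0// exprn_ge0.
have int1 := intD m j isT (ltn_trans (ltnW (ltnSn _)) jm).
have int2 := intD m j.+2 isT jm.
rewrite /grid_right pt2 -/h in int1 int2.
have := solution_local_bound cb sol h0 A0
  (beta := C * (2 + `|x|)) (p := grid_pt R m j).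
have smallh c : c * (1 + `|x|) <= m%:R -> h * c * (1 + `|x|) <= 1.
  by move=> cm; rewrite -mulrA -[leRHS]hm; apply: ler_wpM2l => //; exact: ltW.
have sub c : c <= K -> c * (1 + `|x|) <= m%:R.
  move=> cK; have : c * (1 + `|x|) <= K * (1 + `|x|) by apply: ler_wpM2r => //; move: x0; clear; lra.
  by move: mK; clear; lra.
have C96 : 96 * C <= K by rewrite /K; move: (normr_ge0 l); clear; lra.
have l12 : 12 * `|l| <= K by rewrite /K; move: C0; clear; lra.
have s1 := smallh _ (sub _ K24).
have s2 := smallh _ (sub _ C96).
have s3 := smallh _ (sub _ l12).
have hx : 0 <= h * `|x| by rewrite mulr_ge0// ltW.
have hC : 0 <= h * C by rewrite mulr_ge0// ltW.
have hCx : 0 <= h * C * `|x| by rewrite mulr_ge0.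
have hl : 0 <= h * `|l| by rewrite mulr_ge0// ltW.
have hlx : 0 <= h * `|l| * `|x| by rewrite mulr_ge0.
have h3 : 3 * h <= 8^-1 by move: s1 hx; clear; lra.
move=> /(_ _ h3) H; apply: (le_trans (H _ _ _ int1 int2 x ptx _)).
- move=> t pt tq; apply: (le_trans (bC t)); apply: ler_wpM2l => //.
  have : `|t - x| <= 1 by rewrite ler_norml; move: pt tq ptx xpt h3 h0; clear; move=> *; apply/andP; split; lra.
  by have := ler_normD x (t - x); rewrite subrKC; clear; lra.
- by move: s2 hC hCx; clear; lra.
- by move: s3 hl hlx; clear; lra.
- by move: xpt h0; clear; lra.
have mpow : (m%:R : R) ^+ q.+1 <= ((K + 1) * (1 + `|x|)) ^+ q.+1.
  by apply: lerXn2r => //; rewrite nnegrE; [exact: ltW|apply: mulr_ge0; move: x0 K24; clear; lra].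
have -> : 18 * (D * m%:R ^+ q / h) = 18 * D * m%:R ^+ q.+1.
  by rewrite /h invrK exprSr; ring.
by rewrite -[leRHS]mulrA -exprMn; apply: ler_wpM2l => //; exact: mulr_ge0.
Qed.

(** A polynomial bound is reduced to [ln (1 + |x|)], and
    [ln u <= eta u - ln eta] for every [eta > 0]. Stated for any filter along
    which [|x|] tends to infinity, to serve at both ends of the line. *)
Lemma ln_growth_cvg0 (R : realType) (F : set_system R) (FF : Filter F)
    (y : R -> R) (C : R) (q : nat) :
  (forall M, \forall x \near F, M < `|x|) -> 0 <= C ->
  (forall x, `|y x| <= C * (1 + `|x|) ^+ q) ->
  ln (1 + `|y x|) / `|x| @[x --> F] --> 0.
Proof.
move=> Finfty C0 yC; apply/cvgrPdist_lt => e e0.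
(* [q * eta <= e / 2]; the shift avoids a division by zero when [q = 0] *)
pose eta := e / 2 / q.+1%:R.
have eta0 : 0 < eta by rewrite !divr_gt0.
have qeta : q%:R * eta <= e / 2.
  rewrite /eta mulrCA ler_piMr ?divr_ge0 1?ltW//.
  by rewrite ltr_pdivrMr// mul1r ltr_nat.
pose c := ln (1 + C) + q%:R * (eta - ln eta).
near=> x.
have x1 : Num.max 1 (2 * `|c| / e) < `|x| by near: x; exact: Finfty.
have {x1}[x1 xc] : 1 < `|x| /\ 2 * `|c| / e < `|x|.
  by move: x1; rewrite gt_max => /andP[].
have x0 : 0 < `|x| by apply: lt_trans x1.
have ln0 : 0 <= ln (1 + `|y x|) by rewrite ln_ge0// lerDl.
rewrite sub0r normrN ger0_norm; last by rewrite divr_ge0.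
rewrite ltr_pdivrMr//.
have lnx : ln (1 + `|x|) <= eta * (1 + `|x|) - ln eta.
  rewrite lerBrDr -lnM ?posrE// ?ltr_pDl// mulrC.
  by apply/ltW/ln_sublinear; rewrite mulr_gt0 ?ltr_pDl.
have Y : ln (1 + `|y x|) <= ln (1 + C) + q%:R * ln (1 + `|x|).
  have p1 : 1 <= (1 + `|x|) ^+ q by rewrite exprn_ege1// lerDl.
  have x10 : 0 < 1 + `|x| by rewrite ltr_pDl.
  have C10 : 0 < 1 + C by rewrite ltr_wpDr.
  have y10 : 0 < 1 + `|y x| by rewrite ltr_wpDr.
  have xq0 : 0 < (1 + `|x|) ^+ q by rewrite exprn_gt0.
  rewrite mulr_natl -lnXn// -lnM ?posrE// ler_ln ?posrE ?mulr_gt0//.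
  by rewrite mulrDl mul1r; apply: lerD.
have q0 : (0 : R) <= q%:R by [].
have H1 : q%:R * ln (1 + `|x|) <= q%:R * (eta * (1 + `|x|) - ln eta) by apply: ler_wpM2l.
have H2 : q%:R * eta * `|x| <= e / 2 * `|x| by apply: ler_wpM2r.
have cE : c = ln (1 + C) + q%:R * (eta - ln eta) by [].
have H3 : c <= `|c| by exact: ler_norm.
have H4 : 2 * `|c| < `|x| * e by rewrite -ltr_pdivrMr.
apply: (le_lt_trans Y); apply: (le_lt_trans (lerD (lexx _) H1)).
apply: (@le_lt_trans _ _ (c + q%:R * eta * `|x|)); first by rewrite cE; lra.
by lra.
Unshelve. all: end_near. Qed.

(** * The Hilbert space, product integrals *)

Section L2_inner_product.
Context {R : realType}.
Implicit Types f g h : L2 R.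

Lemma ip_integrable f g :
  (@lebesgue_measure R).-integrable setT (EFin \o (fun x => f x * g x)).
Proof.
apply/Lfun1_integrable; apply: Lfun2_mul_Lfun1; exact: LfunP.
Qed.

Lemma L2_measurable f : measurable_fun setT (f : R -> R).
Proof. by have := LfunP f; rewrite inE => /andP[]; rewrite inE. Qed.

Lemma ip_ae f g h : (g : R -> R) = h %[ae lebesgue_measure] -> ip f g = ip f h.
Proof.
move=> gh; rewrite /ip /Rintegral; congr fine; apply: ae_eq_integral => //.
- by have /measurable_int := ip_integrable f g.
- by have /measurable_int := ip_integrable f h.
apply: filterS gh; first exact: (ae_filter_ringOfSetsType (@lebesgue_measure R)).
move=> x /(_ I)/= gh _ /=.
by rewrite gh.
Qed.

(** [g] is then the orthogonal projection of [f]: [|f - g|^2 >= 0] expands to the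
    claim. *)
Lemma ip_le_ip_self f g : ip f g = ip g g -> ip f g <= ip f f.
Proof.
move=> fg; rewrite -subr_ge0.
have -> : ip f f - ip f g =
    \int[lebesgue_measure]_x ((f x - g x) * (f x - g x)).
  rewrite (_ : ip f f - ip f g = ip f f - ip f g - (ip f g - ip g g)); last first.
    by rewrite fg subrr subr0.
  rewrite /ip -!RintegralB//; try exact: ip_integrable.
    by apply: eq_Rintegral => x _ /=; ring.
  - rewrite (_ : _ \o _ = (EFin \o (fun x => f x * f x)%R) \-
      (EFin \o (fun x => f x * g x)%R))%E; last exact/funext.
    by apply: integrableB => //; exact: ip_integrable.
  - rewrite (_ : _ \o _ = (EFin \o (fun x => f x * g x)%R) \-
      (EFin \o (fun x => g x * g x)%R))%E; last exact/funext.
    by apply: integrableB => //; exact: ip_integrable.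
by apply: Rintegral_ge0 => x _; rewrite -expr2 sqr_ge0.
Qed.

Lemma pvm_diag_le (E : set R -> L2 R -> L2 R) (A : set R) f :
  is_pvm E -> measurable A -> ip f (E A f) <= ip f f.
Proof.
move=> pE mA; apply: ip_le_ip_self.
by rewrite (pvm_sym pE)//; apply/esym/ip_ae; exact: pvm_idem.
Qed.

End L2_inner_product.

Lemma ip_indic_itv (R : realType) (a b : R) : a <= b ->
  ip (indic_itv a b) (indic_itv a b) = b - a.
Proof.
move=> ab; rewrite /ip.
have -> : \int[lebesgue_measure]_x (indic_itv a b x * indic_itv a b x) =
    \int[lebesgue_measure]_x (\1_`[a, b] x : R).
  by apply: eq_Rintegral => x _; rewrite /= indicE; case: (x \in _);
    rewrite ?mulr1 ?mulr0.
rewrite /Rintegral integral_indic// setIT.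
rewrite [X in fine X](lebesgue_measure_itv `[a, b])/= lte_fin.
by case: ltP => //= ba; apply/esym/eqP; rewrite subr_eq0 eq_le ab ba.
Qed.

(** Tonelli's theorem applied twice, to the positive and negative parts. *)
Lemma measurable_fun_partial_integral d0 d1 d2 (T0 : measurableType d0)
    (T1 : measurableType d1) (T2 : measurableType d2) (R : realType)
    (m1 : {sigma_finite_measure set T1 -> \bar R})
    (m2 : {sigma_finite_measure set T2 -> \bar R})
    (f : T0 * (T1 * T2) -> \bar R) :
  measurable_fun setT f ->
  measurable_fun setT (fun x => \int[m1 \x m2]_z f (x, z))%E.
Proof.
have ge0 g : measurable_fun setT g -> (forall z, 0 <= g z)%E ->
    measurable_fun setT (fun x : T0 => \int[m1 \x m2]_z g (x, z))%E.
  move=> mg g0.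
  have mr : measurable_fun setT (fun z : T0 * T1 * T2 => (z.1.1, (z.1.2, z.2))).
    apply: measurable_fun_pair.
      exact: measurableT_comp measurable_fst measurable_fst.
    apply: measurable_fun_pair; last exact: measurable_snd.
    exact: measurableT_comp measurable_snd measurable_fst.
  have m3 := measurableT_comp mg mr.
  set g' := g \o _ in m3.
  have g'0 z : (0 <= g' z)%E by exact: g0.
  have mF : measurable_fun setT (fubini_F m2 g').
    exact: measurable_fun_fubini_tonelli_F.
  have mF0 z : (0 <= fubini_F m2 g' z)%E by exact: integral_ge0.
  have : measurable_fun setT (fubini_F m1 (fubini_F m2 g')).
    exact: measurable_fun_fubini_tonelli_F.
  congr (measurable_fun _ _); apply/funext => x.
  rewrite fubini_tonelli1//.
  by apply: measurableT_comp mg _; exact: measurable_fun_pair.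
move=> mf; rewrite (_ : (fun _ => _) =
  (fun x => \int[m1 \x m2]_z f^\+ (x, z)) \-
  (fun x => \int[m1 \x m2]_z f^\- (x, z)))%E.
  apply: emeasurable_funB; apply: ge0 => //.
    exact: measurable_funepos.
  exact: measurable_funeneg.
apply/funext => x; rewrite [LHS]integralE.
by congr (_ - _)%E; apply: eq_integral => y _; rewrite ?funeposE ?funenegE.
Qed.

Section tensor.
Context {R : realType}.
Let leb := @lebesgue_measure R.

Lemma integral_tensor (u v : R -> R) :
  leb.-integrable setT (EFin \o u) -> leb.-integrable setT (EFin \o v) ->
  (leb \x leb)%E.-integrable setT (fun z => (u z.1 * v z.2)%:E) /\
  (\int[leb \x leb]_z (u z.1 * v z.2)%:E =
   (\int[leb]_x u x * \int[leb]_x v x)%:E)%E.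
Proof.
move=> iu iv.
have mu : measurable_fun setT u by apply/measurable_EFinP; exact: measurable_int iu.
have mv : measurable_fun setT v by apply/measurable_EFinP; exact: measurable_int iv.
have muv : measurable_fun setT (fun z : measurableTypeR R * measurableTypeR R =>
    (u z.1 * v z.2)%:E).
  apply/measurable_EFinP; apply: measurable_funM.
    exact: measurableT_comp mu measurable_fst.
  exact: measurableT_comp mv measurable_snd.
have fin (w : R -> R) : leb.-integrable setT (EFin \o w) ->
    (\int[leb]_x (w x)%:E = (\int[leb]_x w x)%:E)%E.
  by move=> iw; rewrite /Rintegral fineK//; exact: integrable_fin_num.
have iuv : (leb \x leb)%E.-integrable setT
    (fun z : measurableTypeR R * measurableTypeR R => (u z.1 * v z.2)%:E).
  apply/integrable12ltyP => //.
  have -> : (\int[leb]_x \int[leb]_y `|(u (x, y).1 * v (x, y).2)%:E| =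
     \int[leb]_x (`|u x|%:E * \int[leb]_y `|v y|%:E))%E.
    apply: eq_integral => x _ /=.
    rewrite -ge0_integralZl//.
    - by apply: eq_integral => y _; rewrite normrM EFinM.
    - by apply/measurable_EFinP/measurableT_comp.
  have iav := integrable_norm iv.
  have /fin E := iav.
  rewrite ge0_integralZr//.
  - rewrite [X in (_ * X)%E]E.
    have iau := integrable_norm iu.
    by have /fin -> := iau; rewrite -EFinM ltry.
  - by apply/measurable_EFinP/measurableT_comp.
  - exact: integral_ge0.
split => //; rewrite -integral12_prod_meas1//= /fubini_F/=.
have -> : (\int[leb]_x \int[leb]_y (u x * v y)%:E =
     \int[leb]_x ((u x)%:E * (\int[leb]_y v y)%:E))%E.
  apply: eq_integral => x _ /=; rewrite -fin//.
  by rewrite -integralZl//.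
by rewrite integralZr// [X in (X * _)%E]fin.
Qed.

End tensor.

(** * Averages of the generalized eigenfunctions *)

(** This and the next lemma are the Borel-Cantelli argument used twice below, in
    the form: a series of nonnegative functions whose integrals are summable
    converges almost everywhere, so its terms are bounded by one constant. *)
Lemma summable_integral_series d (T : measurableType d) (R : realType)
    (mu : {measure set T -> \bar R}) (G : nat -> T -> \bar R) (u : nat -> R)
    (c : R) :
  (forall n, measurable_fun setT (G n)) -> (forall n x, (0 <= G n x)%E) ->
  (forall n, (\int[mu]_x G n x <= (u n)%:E)%E) ->
  (forall N, \sum_(n < N) u n <= c) ->
  (\int[mu]_x (\sum_(n <oo) G n x) <= c%:E)%E.
Proof.
move=> mG G0 Gu uc; rewrite integral_nneseries//.
apply: lime_le.
  by apply: is_cvg_nneseries => n _ _; exact: integral_ge0.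
apply: nearW => N; apply: (@le_trans _ _ (\sum_(n < N) (u n)%:E)%E).
  by rewrite big_mkord; apply: lee_sum => n _.
by rewrite sumEFin lee_fin.
Qed.

Lemma summable_integral_ae_bounded d (T : measurableType d) (R : realType)
    (mu : {measure set T -> \bar R}) (G : nat -> T -> \bar R) (u : nat -> R)
    (c : R) :
  (forall n, measurable_fun setT (G n)) -> (forall n x, (0 <= G n x)%E) ->
  (forall n, (\int[mu]_x G n x <= (u n)%:E)%E) ->
  (forall N, \sum_(n < N) u n <= c) ->
  {ae mu, forall x, exists2 C : R, 0 <= C & forall n, (G n x <= C%:E)%E}.
Proof.
move=> mG G0 Gu uc; have Sc := summable_integral_series mG G0 Gu uc.
have S0 x : (0 <= \sum_(n <oo) G n x)%E by exact: nneseries_ge0.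
have iS : mu.-integrable setT (fun x => \sum_(n <oo) G n x)%E.
  apply/integrableP; split.
    by apply: ge0_emeasurable_sum => // n x _ _; exact: G0.
  under eq_integral do rewrite gee0_abs//.
  by rewrite (le_lt_trans Sc)// ltry.
apply: filterS (integrable_ae measurableT iS) => x /(_ I) Sfin.
exists (fine (\sum_(n <oo) G n x)%E); first exact: fine_ge0.
move=> n; rewrite fineK//; apply: (@le_trans _ _ (\sum_(0 <= k < n.+1) G k x)%E).
  by rewrite big_nat_recr//= leeDr// sume_ge0.
by apply: nneseries_lim_ge => k _.
Qed.

Section kernel_averages.
Context {R : realType} (b : R -> R) (E : set R -> L2 R -> L2 R)
  (rho : {measure set (measurableTypeR R) -> \bar R})
  (K : R -> R -> R -> R) (m : R -> nat) (phi : forall l : R, 'I_(m l) -> R -> R).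
Hypotheses (cb : continuous b) (pvmE : is_pvm E)
  (disK : eigen_disintegration b E rho K phi).

Local Notation leb := (@lebesgue_measure R).

Let kernel_avg (s t l : R) : \bar R :=
  (\int[leb \x leb]_z (K l z.1 z.2 * indic_itv s t z.1 * indic_itv s t z.2)%:E)%E.

Lemma measurable_kernel_avg s t :
  measurable_fun (setT : set (measurableTypeR R)) (kernel_avg s t).
Proof.
have m1 : measurable_fun setT (fun z : measurableTypeR R *
    (measurableTypeR R * measurableTypeR R) => ((z.1, z.2.1), z.2.2)).
  apply: measurable_fun_pair; last exact: measurableT_comp measurable_snd measurable_snd.
  apply: measurable_fun_pair; first exact: measurable_fst.
  exact: measurableT_comp measurable_fst measurable_snd.
have mi := @L2_measurable R (indic_itv s t).
have mf : measurable_fun setT (fun z : measurableTypeR R *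
    (measurableTypeR R * measurableTypeR R) =>
  (K z.1 z.2.1 z.2.2 * indic_itv s t z.2.1 * indic_itv s t z.2.2)%:E);
  last first.
  exact: (measurable_fun_partial_integral lebesgue_measure lebesgue_measure mf).
apply/measurable_EFinP; apply: measurable_funM; first apply: measurable_funM.
- exact: measurableT_comp (disint_measurable disK) m1.
- apply: (measurableT_comp mi); exact: measurableT_comp measurable_fst measurable_snd.
- apply: (measurableT_comp mi); exact: measurableT_comp measurable_snd measurable_snd.
Qed.

(** The kernel is a finite sum of products, so its average over a square is a
    sum of squares of averages. *)
Lemma kernel_avg_eigenfunctions (s t l : R) :
  (forall i, solution b l (@phi l i)) ->
  (forall x y, K l x y = \sum_(i < m l) @phi l i x * @phi l i y) ->
  kernel_avg s t l = (\sum_(i < m l) (\int[leb]_(x in `[s, t]) @phi l i x) ^+ 2)%:E.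
Proof.
move=> sol KE; pose F i x := @phi l i x * \1_`[s, t] x.
have iF i : leb.-integrable setT (EFin \o F i).
  have [cphi _] := solution_continuous cb (sol i).
  have := continuous_integrable_itv s t cphi.
  rewrite integrable_mkcond//; apply: eq_integrable => // x _.
  rewrite /F /= patchE indicE; case: (x \in _); by rewrite /= ?mulr1 ?mulr0.
have FE i : \int[leb]_x F i x = \int[leb]_(x in `[s, t]) @phi l i x.
  rewrite [RHS]Rintegral_mkcond; apply: eq_Rintegral => x _.
  by rewrite /F /= patchE indicE; case: (x \in _); rewrite /= ?mulr1 ?mulr0.
rewrite /kernel_avg.
transitivity (\int[leb \x leb]_z (\sum_(i < m l) (F i z.1 * F i z.2)%:E))%E.
  apply: eq_integral => z _; rewrite sumEFin; congr EFin.
  rewrite KE !big_distrl/=; apply: eq_bigr => i _; rewrite /F; ring.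
rewrite integral_sum//; last by move=> i; have [] := integral_tensor (iF i) (iF i).
rewrite -sumEFin; apply: eq_bigr => i _.
by have [_ ->] := integral_tensor (iF i) (iF i); rewrite FE expr2.
Qed.

Lemma ae_kernel_avg_ge0 : {ae rho, forall l, forall s t, (0 <= kernel_avg s t l)%E}.
Proof.
apply: filterS (disint_eigenfunctions disK).
  exact: (ae_filter_ringOfSetsType rho).
move=> l [_ sol _ KE] s t.
rewrite kernel_avg_eigenfunctions// lee_fin.
by apply: sumr_ge0 => i _; exact: sqr_ge0.
Qed.

Lemma bounded_compact_support_indic_itv (s t : R) :
  bounded_compact_support (indic_itv s t).
Proof.
split.
  exists 1 => x; rewrite /= indicE.
  by case: (x \in _); rewrite ?normr1 ?normr0.
exists (Num.max `|s| `|t|) => x; rewrite gt_max => /andP[sx tx].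
rewrite /= indicE; case: (boolP (x \in _)) => //; rewrite inE/= in_itv/= => /andP[sx' xt'].
exfalso; have := ler_norm t; have := ler_norm (- s); rewrite normrN.
have [x0|x0] := lerP 0 x; move: sx tx; last by rewrite (ltr0_norm x0); lra.
by rewrite (ger0_norm x0); lra.
Qed.

(** The left side is [<f, E(A) f>] for [f] the indicator of [[s, t]], because the
    integrand is nonnegative almost everywhere, and [<f, f> = t - s]. *)
Lemma integral_kernel_avg_le (A : set R) (s t : R) : s <= t ->
  measurable A -> bounded_set A ->
  (\int[rho]_l `|(\1_A l)%:E * kernel_avg s t l| <= (t - s)%:E)%E.
Proof.
move=> st mA bA.
have mk : measurable_fun (setT : set (measurableTypeR R))
    (fun l => (\1_A l)%:E * kernel_avg s t l)%E.
  apply: emeasurable_funM; last exact: measurable_kernel_avg.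
  by apply/measurable_EFinP.
apply: (@le_trans _ _ (\int[rho]_l ((\1_A l)%:E * kernel_avg s t l))%E).
  rewrite le_eqVlt; apply/orP; left; apply/eqP.
  apply: ae_eq_integral => //; first exact: measurableT_comp.
  apply: filterS ae_kernel_avg_ge0; first exact: (ae_filter_ringOfSetsType rho).
  move=> l /(_ s t) k0 _.
  by rewrite gee0_abs// mule_ge0.
have bcs := bounded_compact_support_indic_itv s t.
rewrite -(disint_kernel disK bcs bcs mA bA) lee_fin -ip_indic_itv//.
exact: pvm_diag_le.
Qed.

End kernel_averages.

Section generalized_eigenfunctions.
Context {R : realType} (b : R -> R) (E : set R -> L2 R -> L2 R)
  (rho : {measure set (measurableTypeR R) -> \bar R})
  (K : R -> R -> R -> R) (m : R -> nat) (phi : forall l : R, 'I_(m l) -> R -> R).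
Hypotheses (cb : continuous b) (pvmE : is_pvm E)
  (disK : eigen_disintegration b E rho K phi).

Local Notation leb := (@lebesgue_measure R).

(** The [2 n^2] cells of the n-th grid contribute at most [2 n^2 * (1/n) = 2 n],
    so that weights of order [n^-3] give a telescoping, summable series. *)
Lemma eigenfunction_averages_bounded (N : nat) :
  {ae rho, forall l, `|l| <= N%:R -> exists2 D : R, 0 <= D &
    forall n j, (0 < n)%N -> (j < 2 * n ^ 2)%N -> forall i,
    `|\int[leb]_(x in `[grid_pt R n j, grid_right R n j]) @phi l i x|
      <= D * n%:R ^+ 2}.
Proof.
pose A : set R := `[- N%:R, N%:R]%classic.
have mA : measurable A by exact: measurable_itv.
have bA : bounded_set A.
  exists N%:R; split; first exact: num_real.
  move=> M NM x; rewrite /A/= in_itv/= => /andP[xl xr].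
  by rewrite (le_trans _ (ltW NM))// ler_norml xl.
pose k n j l : \bar R :=
  (\int[leb \x leb]_z (K l z.1 z.2 * indic_itv (grid_pt R n j) (grid_right R n j) z.1
    * indic_itv (grid_pt R n j) (grid_right R n j) z.2)%:E)%E.
(* grids are numbered from one: [n.+1] is the index of the grid *)
pose w n : R := (n.+1%:R ^+ 2 * n.+2%:R)^-1.
have w0 n : 0 < w n by rewrite invr_gt0 mulr_gt0 ?exprn_gt0.
pose g n j l : \bar R := `|(\1_A l)%:E * k n.+1 j l|%E.
have mg n j : measurable_fun (setT : set (measurableTypeR R)) (g n j).
  apply: measurableT_comp => //; apply: emeasurable_funM.
    exact/measurable_EFinP.
  exact: (@measurable_kernel_avg _ _ _ _ _ _ _ disK).
have intg n j : (\int[rho]_l g n j l <= (n.+1%:R^-1)%:E)%E.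
  have gr : grid_pt R n.+1 j <= grid_right R n.+1 j by rewrite lerDl invr_ge0.
  apply: le_trans (integral_kernel_avg_le cb pvmE disK gr mA bA) _.
  by rewrite lee_fin /grid_right addrC addrA addNr add0r.
pose G n l : \bar R := ((w n)%:E * \sum_(j < 2 * n.+1 ^ 2) g n j l)%E.
pose u n : R := 2 * (n.+1%:R^-1 - n.+2%:R^-1).
have mG n : measurable_fun (setT : set (measurableTypeR R)) (G n).
  apply: emeasurable_funM; first exact: measurable_cst.
  by apply: emeasurable_sum => j; exact: mg.
have G0 n l : (0 <= G n l)%E.
  by apply: mule_ge0; [rewrite lee_fin ltW|apply: sume_ge0 => j _; exact: abse_ge0].
have Gu n : (\int[rho]_l G n l <= (u n)%:E)%E.
  rewrite ge0_integralZl//; last 3 first.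
  - by apply: emeasurable_sum => j; exact: mg.
  - by move=> l _; apply: sume_ge0 => j _; exact: abse_ge0.
  - by rewrite lee_fin ltW.
  rewrite ge0_integral_sum//; last by move=> j l _; exact: abse_ge0.
  apply: (@le_trans _ _ ((w n)%:E * \sum_(j < 2 * n.+1 ^ 2) (n.+1%:R^-1)%:E)%E).
    apply: lee_wpmul2l; first by rewrite lee_fin ltW.
    by apply: lee_sum => j _; exact: intg.
  rewrite sumEFin -EFinM lee_fin sumr_const card_ord -[X in _ * X <= _]mulr_natr natrM natrX.
  rewrite le_eqVlt; apply/orP; left; apply/eqP.
  rewrite /w /u; have n1 : n.+1%:R != 0 :> R by rewrite pnatr_eq0.
  have n2 : n.+2%:R != 0 :> R by rewrite pnatr_eq0.
  have n21 : n.+2%:R = n.+1%:R + 1 :> R by rewrite natr1.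
  move: n1 n2; rewrite n21; move: (n.+1%:R) => x x0 x1.
  by field; rewrite x0 x1.
have uc M : \sum_(n < M) u n <= 2.
  rewrite -mulr_sumr -(big_mkord xpredT (fun n => n.+1%:R^-1 - n.+2%:R^-1 : R)).
  rewrite (eq_bigr (fun n => - n.+2%:R^-1 - - n.+1%:R^-1)); last first.
    by move=> n _; rewrite opprK addrC.
  rewrite telescope_sumr// opprK invr1.
  have : 0 <= (M.+1%:R : R)^-1 by [].
  by move: (M.+1%:R^-1) => x; lra.
have := summable_integral_ae_bounded mG G0 Gu uc.
have := disint_eigenfunctions disK.
apply: filterS2; first exact: (ae_filter_ringOfSetsType rho).
move=> l [_ sol _ KE] [C C0 GC] lN.
exists (1 + 2 * C) => [|[//|n] j _ jn i]; first by rewrite addr_ge0 ?mulr_ge0.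
have Al : (\1_A l : R) = 1.
  by rewrite indicE mem_set// /A/= in_itv/= -ler_norml.
have kE := kernel_avg_eigenfunctions cb (grid_pt R n.+1 j) (grid_right R n.+1 j) sol KE.
set I := \int[_]_(x in _) _.
have I2 : ((I ^+ 2)%:E <= g n j l)%E.
  rewrite /g Al mul1e /k kE /= lee_fin ger0_norm; last first.
    by apply: sumr_ge0 => i' _; exact: sqr_ge0.
  by rewrite (bigD1 i)//= lerDl; apply: sumr_ge0 => i' _; exact: sqr_ge0.
have gC : ((w n)%:E * g n j l <= C%:E)%E.
  apply: le_trans (GC n); rewrite /G; apply: lee_wpmul2l.
    by rewrite lee_fin ltW.
  rewrite (bigD1 (Ordinal jn))//= leeDl//.
  by apply: sume_ge0 => j' _; exact: abse_ge0.
have wI : w n * I ^+ 2 <= C.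
  rewrite -lee_fin; apply: le_trans gC; rewrite EFinM; apply: lee_wpmul2l => //.
  by rewrite lee_fin ltW.
have {wI}I2C : I ^+ 2 <= C * (n.+1%:R ^+ 2 * n.+2%:R).
  by rewrite -ler_pdivrMr ?mulr_gt0 ?exprn_gt0// mulrC.
have N1 : 1 <= n.+1%:R :> R by rewrite ler1n.
have n21 : n.+2%:R = n.+1%:R + 1 :> R by rewrite natr1.
move: N1 I2C; rewrite n21; set x := (n.+1%:R : R) => x1 I2C.
have x2 : x ^+ 2 * (x + 1) <= 2 * x ^+ 4 by nra.
have x40 : 0 <= x ^+ 4 by rewrite exprn_even_ge0.
have Dx0 : 0 <= (1 + 2 * C) * x ^+ 2 by rewrite mulr_ge0 ?exprn_even_ge0//; lra.
rewrite -(@ler_pXn2r _ 2%N) ?nnegrE//.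
rewrite real_normK ?num_real// (le_trans I2C)//.
rewrite exprMn -exprM; apply: (le_trans (ler_wpM2l C0 x2)).
have : 0 <= C * C * x ^+ 4 by rewrite mulr_ge0// mulr_ge0.
have : 0 <= C * x ^+ 4 by rewrite mulr_ge0.
rewrite (_ : (2 * 2 = 4)%N)//; move: (x ^+ 4) x40 => y y0 H1 H2.
by nra.
Qed.

Lemma eigenfunction_growth (C : R) :
  0 <= C -> (forall t, `|b t| <= C * (1 + `|t|)) ->
  {ae rho, forall l, forall i : 'I_(m l),
      ((ln (1 + `|@phi l i x|) / `|x|) @[x --> +oo] --> (0 : R)) /\
      ((ln (1 + `|@phi l i x|) / `|x|) @[x --> -oo] --> (0 : R))}.
Proof.
move=> C0 bC.
have aeN := ae_foralln eigenfunction_averages_bounded.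
have := disint_eigenfunctions disK; move: aeN.
apply: filterS2 => l avg [_ sol _ _] i.
have lN : `|l| <= (Num.truncn `|l|).+1%:R by rewrite ltW// truncnS_gt.
have [D D0 avgD] := avg _ lN.
have [C' C'0 yC'] := solution_poly_growth cb (sol i) C0 D0 bC
  (fun n j n0 jn => avgD n j n0 jn i).
split; apply: ln_growth_cvg0 C'0 yC' => M.
- near=> x; apply: (@lt_le_trans _ _ x); last exact: ler_norm.
  by near: x; apply: nbhs_pinfty_gt; rewrite num_real.
- near=> x; apply: (@lt_le_trans _ _ (- x)); last by rewrite -normrN ler_norm.
  by rewrite ltrNr; near: x; apply: nbhs_ninfty_lt; rewrite num_real.
Unshelve. all: end_near. Qed.

End generalized_eigenfunctions.

(** * Moments of Gaussian variables *)

Section normal_moments.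
Context {R : realType}.
Implicit Types m s : R.
Local Notation leb := (@lebesgue_measure R).

(** The density with respect to Lebesgue measure is the Radon-Nikodym derivative
    up to a null set. *)
Lemma ge0_integral_normal_prob m s (f : R -> \bar R) :
  (forall x, (0 <= f x)%E) -> measurable_fun setT f ->
  (\int[normal_prob m s]_x f x = \int[leb]_x (f x * (normal_pdf m s x)%:E))%E.
Proof.
move=> f0 mf; have dom := normal_prob_dominates m s.
rewrite -(Radon_Nikodym_SigmaFinite.change_of_variables dom)//.
apply: ae_eq_integral => //.
- apply: emeasurable_funM => //.
  exact: measurable_int (Radon_Nikodym_SigmaFinite.f_integrable dom).
- apply: emeasurable_funM => //; apply/measurable_EFinP.
  exact: measurable_normal_pdf.
apply: ae_eqe_mul2l.
apply: integral_ae_eq => //.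
- exact: Radon_Nikodym_SigmaFinite.f_integrable.
- by apply/measurable_EFinP; exact: measurable_normal_pdf.
- by move=> A _ mA; rewrite -Radon_Nikodym_SigmaFinite.f_integral.
Qed.

Lemma normal_peak_le s : 0 < s -> normal_peak s * s <= 2^-1.
Proof.
move=> s0; rewrite /normal_peak -ler_pdivlMr// -invfM lef_pV2 ?posrE ?mulr_gt0//.
  rewrite -(@ler_pXn2r _ 2%N) ?nnegrE ?sqrtr_ge0//; last by rewrite mulr_ge0// ltW.
  rewrite sqr_sqrtr; last by rewrite mulrn_wge0// mulr_ge0 ?sqr_ge0// pi_ge0.
  rewrite -[leRHS]mulr_natr exprMn; have := pi_ge2 R.
  by have : 0 <= s ^+ 2 by [rewrite sqr_ge0]; nra.
by rewrite sqrtr_gt0 mulrn_wgt0// mulr_gt0 ?pi_gt0// exprn_gt0.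
Qed.

(** A Gaussian law, wherever it is centred, leaves mass at least one half at
    distance more than [s / 2] from the origin; this is what allows the standard
    deviation to be controlled by the second moment without knowing the mean. *)
Lemma normal_prob_small_itv m s : 0 < s ->
  (normal_prob m s `[(- (s / 2))%R, (s / 2)%R] <= 2^-1%:E)%E.
Proof.
move=> s0; rewrite /normal_prob.
apply: (@le_trans _ _ (\int[leb]_(x in `[(- (s / 2))%R, (s / 2)%R]) (normal_peak s)%:E)%E).
  apply: ge0_le_integral => //.
  - by move=> x _; rewrite lee_fin normal_pdf_ge0.
  - by apply/measurable_EFinP/measurable_funTS; exact: measurable_normal_pdf.
  - by move=> x _; rewrite lee_fin normal_pdf_ub// gt_eqF.
rewrite integral_cst//.
rewrite [X in (_ * X <= _)%E](lebesgue_measure_itv `[(- (s / 2))%R, (s / 2)%R])/=.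
have h : - (s / 2) < s / 2 by lra.
rewrite lte_fin h.
rewrite -EFinB (_ : s / 2 - - (s / 2) = s); last by lra.
by rewrite -EFinM lee_fin normal_peak_le.
Qed.

(** Part of the exponential decay pays for the fourth power: with
    [w = (x - m)^2 / (4 s^2)], the inequality [w^2 <= 2 exp w] trades [w^2] for a
    wider Gaussian, whose integral is one. No moment has to be computed. *)
Lemma normal_pdf_fourth_power m s x : 0 < s ->
  (x - m) ^+ 4 * normal_pdf m s x <= 64 * s ^+ 4 * normal_pdf m (2 * s) x.
Proof.
move=> s0; have s20 : 0 < 2 * s by rewrite mulr_gt0.
rewrite !normal_pdfE ?gt_eqF// /normal_fun.
have -> : normal_peak s = 2 * normal_peak (2 * s).
  rewrite /normal_peak (_ : (2 * s) ^+ 2 * pi *+ 2 = 2 ^+ 2 * (s ^+ 2 * pi *+ 2)).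
    by rewrite sqrtrM ?sqr_ge0// sqrtr_sqr ger0_norm// invfM mulrA mulfV// mul1r.
  by rewrite -[LHS]mulr_natr -[in RHS]mulr_natr; ring.
set w := (x - m) ^+ 2 / (4 * s ^+ 2).
have s2 : s ^+ 2 != 0 by rewrite expf_neq0// gt_eqF.
have w0 : 0 <= w by rewrite divr_ge0 ?sqr_ge0// mulr_ge0// sqr_ge0.
have -> : (x - m) ^+ 4 = 16 * s ^+ 4 * w ^+ 2.
  by rewrite /w; field; rewrite gt_eqF.
have -> : - (x - m) ^+ 2 / (s ^+ 2 *+ 2) = - w + - w.
  by rewrite /w -mulr_natr; field; rewrite gt_eqF.
have -> : - (x - m) ^+ 2 / ((2 * s) ^+ 2 *+ 2) = - w / 2.
  by rewrite /w -mulr_natr; field; rewrite gt_eqF.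
have ew : w ^+ 2 * expR (- w) <= 2.
  rewrite expRN ler_pdivrMr ?expR_gt0//.
  have := expR_ge1Dxn 1 w0; rewrite (_ : (2`!)%:R = 2)//.
  by lra.
have ew2 : expR (- w) <= expR (- w / 2) by rewrite ler_expR; lra.
rewrite expRD.
have p0 : 0 <= normal_peak (2 * s) by exact: normal_peak_ge0.
have s4 : 0 <= s ^+ 4 by rewrite exprn_ge0// ltW.
have E0 : 0 < expR (- w) by exact: expR_gt0.
have H : w ^+ 2 * expR (- w) * expR (- w) <= 2 * expR (- w / 2).
  by apply: ler_pM => //; apply: mulr_ge0; [exact: sqr_ge0|exact: ltW].
have := ler_wpM2l (mulr_ge0 s4 p0) H.
by lra.
Qed.

Lemma normal_fourth_moment m s : 0 < s ->
  (\int[normal_prob m s]_x ((x - m) ^+ 4)%:E <= (64 * s ^+ 4)%:E)%E.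
Proof.
move=> s0; rewrite ge0_integral_normal_prob; last 2 first.
- by move=> x; rewrite lee_fin exprn_even_ge0.
- apply/measurable_EFinP/measurable_funX; exact: measurable_funB.
apply: (@le_trans _ _ (\int[leb]_x ((64 * s ^+ 4)%:E * (normal_pdf m (2 * s) x)%:E))%E).
  apply: ge0_le_integral => //.
  - by move=> x _; rewrite lee_fin mulr_ge0 ?normal_pdf_ge0// exprn_even_ge0.
  - apply: emeasurable_funM; apply/measurable_EFinP; last exact: measurable_normal_pdf.
    by apply: measurable_funX; exact: measurable_funB.
  - apply: emeasurable_funM; first exact: measurable_cst.
    by apply/measurable_EFinP; exact: measurable_normal_pdf.
  - by move=> x _; rewrite -!EFinM lee_fin normal_pdf_fourth_power.
rewrite integralZl//; last exact: integrable_normal_pdf.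
by rewrite integral_normal_pdf mule1.
Qed.

End normal_moments.

(** Comes from [m^2 <= 2 x^2 + 2 (x - m)^2] and [2 u <= u^2 / s^2 + s^2]; it bounds
    the mean of a Gaussian variable by moments that are already controlled. *)
Lemma sqr_le_fourth_power (R : realFieldType) (x m s : R) : 0 < s ->
  m ^+ 2 <= 2 * x ^+ 2 + 2 / s ^+ 2 * (x - m) ^+ 4 + 2 * s ^+ 2.
Proof.
move=> s0; have := sqr_ge0 ((x - m) ^+ 2 / s - s).
have -> : ((x - m) ^+ 2 / s - s) ^+ 2 =
  2^-1 * (2 / s ^+ 2 * (x - m) ^+ 4) - 2 * (x - m) ^+ 2 + s ^+ 2.
  by field; rewrite gt_eqF.
have := sqr_ge0 (2 * x - m); move: (2 / _ * _) => z; nra.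
Qed.

Lemma fourth_powerD_le (R : realFieldType) (y m : R) :
  (y + m) ^+ 4 <= 8 * y ^+ 4 + 8 * m ^+ 4.
Proof.
have -> : 8 * y ^+ 4 + 8 * m ^+ 4 = (y + m) ^+ 4 + (y - m) ^+ 4
  + 6 * (y ^+ 2 - m ^+ 2) ^+ 2 by ring.
by rewrite -addrA lerDl addr_ge0 ?exprn_even_ge0// mulr_ge0// sqr_ge0.
Qed.

Section gaussian.
Context {R : realType} d {Omega : measurableType d} (P : probability Omega R).
Implicit Types D : {RV P >-> R}.

Lemma integral_gaussian_law D m s (f : R -> R) :
  (forall A : set R, measurable A -> P [set w | A (D w)] = gaussian_law m s A) ->
  s != 0 -> (forall x, 0 <= f x) -> measurable_fun setT f ->
  (\int[P]_w (f (D w))%:E = \int[normal_prob m s]_x (f x)%:E)%E.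
Proof.
move=> lawD s0 f0 mf.
(* Gaussian laws live on [measurableTypeR R], random variables take values in [R];
   the two carry the same measurable sets under different displays *)
have mD : measurable_fun setT (D : Omega -> measurableTypeR R).
  by have : measurable_fun setT D by exact: measurable_funPT.
have mfD : (D : Omega -> measurableTypeR R) \in mfun by rewrite inE.
pose D' : {mfun Omega >-> measurableTypeR R} := mfun_Sub mfD.
have f0' y : (0 <= (EFin \o f) y)%E by rewrite lee_fin.
have mf' : measurable_fun (setT : set (measurableTypeR R)) (EFin \o f).
  exact/measurable_EFinP.
have := @ge0_integral_pushforward _ _ _ (measurableTypeR R) _ D' mD P setT
  (EFin \o f) measurableT mf' (in1W f0').
rewrite preimage_setT => <-.
apply: (@eq_measure_integral _ _ _ setT (normal_prob m s) (distribution P D')).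
move=> A mA _.
by have := lawD A mA; rewrite /gaussian_law (negbTE s0).
Qed.

Let int_le (f g : Omega -> R) : measurable_fun setT f -> measurable_fun setT g ->
  (forall w, 0 <= f w) -> (forall w, f w <= g w) ->
  (\int[P]_w (f w)%:E <= \int[P]_w (g w)%:E)%E.
Proof.
move=> mf mg f0 fg; apply: ge0_le_integral => //.
- by move=> w _; rewrite lee_fin.
- exact/measurable_EFinP.
- exact/measurable_EFinP.
- by move=> w _; rewrite lee_fin.
Qed.

Let int_lin (f g : Omega -> R) (a c x y : R) : measurable_fun setT f ->
  measurable_fun setT g -> (forall w, 0 <= f w) -> (forall w, 0 <= g w) ->
  0 <= a -> 0 <= c ->
  (\int[P]_w (f w)%:E <= x%:E)%E -> (\int[P]_w (g w)%:E <= y%:E)%E ->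
  (\int[P]_w (a * f w + c * g w)%:E <= (a * x + c * y)%:E)%E.
Proof.
move=> mf mg f0 g0 a0 c0 fx gy.
under eq_integral do rewrite EFinD !EFinM.
have mef : measurable_fun setT (fun w => (a%:E * (f w)%:E)%E).
  by apply: emeasurable_funM => //; exact/measurable_EFinP.
have meg : measurable_fun setT (fun w => (c%:E * (g w)%:E)%E).
  by apply: emeasurable_funM => //; exact/measurable_EFinP.
rewrite ge0_integralD//; last 2 first.
- by move=> w _; rewrite mule_ge0// lee_fin.
- by move=> w _; rewrite mule_ge0// lee_fin.
rewrite !ge0_integralZl ?lee_fin//; last 4 first.
- exact/measurable_EFinP.
- by move=> w _; rewrite lee_fin.
- exact/measurable_EFinP.
- by move=> w _; rewrite lee_fin.
by rewrite EFinD !EFinM; apply: leeD; apply: lee_wpmul2l.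
Qed.

Let int_cst (x : R) : (\int[P]_w x%:E = x%:E)%E.
Proof. by rewrite integral_cst// [X in (_ * X)%E](probability_setT P) mule1. Qed.

(** The second moment [v] bounds the standard deviation [s] because the law cannot
    concentrate near the origin, then the mean [m] since the variable stays
    within a few [s] of it, and both together bound the fourth moment. *)
Lemma gaussian_fourth_moment : exists2 c : R, 0 <= c &
  forall D (m s v : R), 0 <= s ->
  (forall A : set R, measurable A -> P [set w | A (D w)] = gaussian_law m s A) ->
  (\int[P]_w (D w ^+ 2)%:E <= v%:E)%E ->
  (\int[P]_w (D w ^+ 4)%:E <= (c * v ^+ 2)%:E)%E.
Proof.
(* [m^2 <= 2 v + 130 s^2] and [s^2 <= 8 v] give [m^2 <= 1042 v];
   [64 * 64] comes from [E (D - m)^4 <= 64 s^4] and [s^4 <= 64 v^2] *)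
have [c1 c1E] : exists c1 : R, c1 = 1042 by exists 1042.
have [c2 c2E] : exists c2 : R, c2 = 64 * 64 by exists (64 * 64).
have c10 : 0 <= c1 by lra.
have c20 : 1 <= c2 by lra.
exists (8 * c2 + 8 * c1 ^+ 2).
  by have := sqr_ge0 c1; lra.
move=> D m s v.
move=> s0 lawD Dv.
have mD : measurable_fun setT D by exact: measurable_funPT.
have mD2 : measurable_fun setT (fun w => D w ^+ 2) by exact: measurable_funX.
have mD4 : measurable_fun setT (fun w => D w ^+ 4) by exact: measurable_funX.
have v0 : 0 <= v.
  by rewrite -lee_fin (le_trans _ Dv)// integral_ge0// => w _; rewrite lee_fin sqr_ge0.
have [s_eq0|s_neq0] := eqVneq s 0.
  have Dm : {ae P, forall w, D w = m}.
    have mNm : measurable (~` [set m]) by exact: measurableC.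
    exists [set w | (~` [set m]) (D w)]; split => //.
    - by rewrite -[X in measurable X]setTI; exact: mD.
    - rewrite lawD// /gaussian_law s_eq0 eqxx.
      by rewrite diracE memNset//=; apply.
  have E k : (\int[P]_w (D w ^+ k)%:E = (m ^+ k)%:E)%E.
    rewrite -int_cst; apply: ae_eq_integral => //.
      by apply/measurable_EFinP; exact: measurable_funX.
    by apply: filterS Dm => w ->.
  move: Dv; rewrite !E !lee_fin => m2v.
  have m20 : 0 <= m ^+ 2 by exact: sqr_ge0.
  rewrite (_ : m ^+ 4 = (m ^+ 2) ^+ 2); last by rewrite -exprM.
  apply: (@le_trans _ _ (v ^+ 2)); first exact: lerXn2r.
  rewrite ler_peMl ?sqr_ge0//.
  by have := sqr_ge0 c1; lra.
have sp : 0 < s by rewrite lt_neqAle eq_sym s_neq0.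
have D2 w : 0 <= D w ^+ 2 by exact: sqr_ge0.
pose U w := (D w - m) ^+ 4.
have U0 w : 0 <= U w by rewrite exprn_even_ge0.
have mU : measurable_fun setT U by apply: measurable_funX; exact: measurable_funB.
have Us : (\int[P]_w (U w)%:E <= (64 * s ^+ 4)%:E)%E.
  rewrite (integral_gaussian_law (f := fun x => (x - m) ^+ 4) lawD)//.
  - exact: normal_fourth_moment.
  - by move=> x; rewrite exprn_even_ge0.
  - by apply: measurable_funX; exact: measurable_funB.
(* [s^2 / 4 <= D^2] outside of an event of probability at most one half *)
have sv : s ^+ 2 <= 8 * v.
  pose I w : R := \1_`[- (s / 2), s / 2] (D w).
  have mI : measurable_fun setT I.
    by apply: measurableT_comp mD; exact: measurable_indic.
  have I0 w : 0 <= I w by rewrite /I indicE.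
  have Ih : (\int[P]_w (I w)%:E <= 2^-1%:E)%E.
    rewrite (integral_gaussian_law (f := \1_`[- (s / 2), s / 2]) lawD)//.
    by rewrite integral_indic// setIT; exact: normal_prob_small_itv.
  have := int_lin mD2 mI D2 I0 ler01 (c := s ^+ 2 / 4) _ Dv Ih.
  have s24 : 0 <= s ^+ 2 / 4 by rewrite divr_ge0// sqr_ge0.
  move=> /(_ s24) H.
  have : (\int[P]_w (s ^+ 2 / 4)%:E <= (1 * v + s ^+ 2 / 4 * 2^-1)%:E)%E.
    apply: le_trans H; apply: int_le => //.
    - by apply: measurable_funD; apply: measurable_funM.
    - move=> w; rewrite mul1r /I indicE; case: (boolP (_ \in _)) => /=.
        by rewrite mulr1 lerDr.
      rewrite notin_setE/= in_itv/= mulr0 addr0 => /negP; rewrite negb_and -!ltNge.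
      by move=> /orP[] ?; nra.
  by rewrite int_cst lee_fin; lra.
have mv : m ^+ 2 <= c1 * v.
  have s2 : 0 < s ^+ 2 by rewrite exprn_gt0.
  have c0 : 0 <= 2 / s ^+ 2 by rewrite divr_ge0 ?sqr_ge0.
  have := int_lin mD2 mU D2 U0 (ler0n _ 2) c0 Dv Us.
  have H2 : (\int[P]_w (2 * s ^+ 2)%:E <= (2 * s ^+ 2)%:E)%E by rewrite int_cst.
  move=> H1.
  have mS : measurable_fun setT (fun w => 2 * D w ^+ 2 + 2 / s ^+ 2 * U w).
    by apply: measurable_funD; apply: measurable_funM.
  have S0 w : 0 <= 2 * D w ^+ 2 + 2 / s ^+ 2 * U w.
    by rewrite addr_ge0// mulr_ge0.
  have cs0 : 0 <= 2 * s ^+ 2 by rewrite mulr_ge0// sqr_ge0.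
  have H3 := int_lin mS (measurable_cst _) S0 (fun=> cs0) ler01 ler01 H1 H2.
  have : (\int[P]_w (m ^+ 2)%:E <= (c1 * v)%:E)%E.
    apply: (le_trans (le_trans _ H3)).
      apply: int_le => //.
      - by apply: measurable_funD; apply: measurable_funM.
      - by move=> w; exact: sqr_ge0.
      - by move=> w; rewrite !mul1r; exact: sqr_le_fourth_power.
    rewrite lee_fin (_ : 2 / s ^+ 2 * (64 * s ^+ 4) = 128 * s ^+ 2); first by rewrite c1E; lra.
    by field; rewrite gt_eqF.
  by rewrite int_cst lee_fin.
have m4v : m ^+ 4 <= c1 ^+ 2 * v ^+ 2.
  rewrite -exprMn (_ : m ^+ 4 = (m ^+ 2) ^+ 2); last by rewrite -exprM.
  by apply: lerXn2r => //; rewrite nnegrE ?sqr_ge0// mulr_ge0.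
have s4v : s ^+ 4 <= 64 * v ^+ 2.
  rewrite (_ : 64 * v ^+ 2 = (8 * v) ^+ 2); last by rewrite exprMn; ring.
  rewrite (_ : s ^+ 4 = (s ^+ 2) ^+ 2); last by rewrite -exprM.
  by apply: lerXn2r => //; rewrite nnegrE ?sqr_ge0// mulr_ge0.
have m40 : 0 <= m ^+ 4 by rewrite exprn_even_ge0.
have Hm : (\int[P]_w (m ^+ 4)%:E <= (m ^+ 4)%:E)%E by rewrite int_cst.
have H := int_lin mU (measurable_cst _) U0 (fun=> m40) (ler0n _ 8) (ler0n _ 8) Us Hm.
apply: (le_trans (le_trans _ H)).
  apply: int_le => //.
  - by apply: measurable_funD; apply: measurable_funM.
  - by move=> w; rewrite exprn_even_ge0.
  - by move=> w; rewrite -[X in X ^+ 4 <= _](subrK m); exact: fourth_powerD_le.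
rewrite lee_fin; have s4v' : 64 * s ^+ 4 <= c2 * v ^+ 2 by rewrite c2E; lra.
by move: s4v' m4v; rewrite mulrDl; lra.
Qed.

End gaussian.

(** * Increments of Brownian motion *)

Lemma ip_indic_itv_sub (R : realType) (a b c d : R) :
  a <= c -> c <= d -> d <= b -> ip (indic_itv a b) (indic_itv c d) = d - c.
Proof.
move=> ac cd db; rewrite -(ip_indic_itv cd) /ip; apply: eq_Rintegral => x _ /=.
rewrite !indicE; case: (boolP (x \in `[c, d]%classic)) => [|_]; last by rewrite !mulr0.
rewrite inE/= in_itv/= => /andP[cx xd].
by rewrite mem_set//= in_itv/= (le_trans ac)// (le_trans xd).
Qed.

Section white_noise.
Context {R : realType} d {Omega : measurableType d} {P : probability Omega R}.
Variables (xi : L2 R -> {RV P >-> R}) (B : R -> {RV P >-> R}).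
Hypotheses (hxi : white_noise xi) (hB : brownian_of xi B).

Lemma white_noise_cov u v : (\int[P]_w (xi u w * xi v w)%:E = (ip u v)%:E)%E.
Proof.
have [_ E0 cov] := hxi; rewrite -cov unlock !E0/=.
rewrite unlock; apply: eq_integral => w _; congr EFin.
by rewrite [RHS](_ : _ = (xi u w - 0) * (xi v w - 0))// !subr0.
Qed.

Lemma white_noise_Lfun2 u : (xi u : Omega -> R) \in Lfun P 2%:E.
Proof.
rewrite inE; apply/andP; split; rewrite inE//=.
rewrite /finite_norm unlock /= poweR_lty//.
have -> : (\int[P]_x ((`|xi u x| `^ 2)%:E) = \int[P]_x (xi u x * xi u x)%:E)%E.
  by apply: eq_integral => x _; rewrite powR_mulrn// real_normK ?num_real// expr2.
by rewrite white_noise_cov ltry.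
Qed.

Lemma white_noise_integrable u v :
  P.-integrable setT (EFin \o (fun w => xi u w * xi v w)).
Proof.
by apply/Lfun1_integrable; apply: Lfun2_mul_Lfun1; exact: white_noise_Lfun2.
Qed.

(** [xi u - xi v] is Gaussian with second moment [|u - v|^2]. *)
Lemma white_noise_increment_fourth : exists2 c : R, 0 <= c & forall u v,
  (\int[P]_w ((xi u w - xi v w) ^+ 4)%:E <=
   (c * (ip u u - 2 * ip u v + ip v v) ^+ 2)%:E)%E.
Proof.
have [c c0 gauss4] := gaussian_fourth_moment P.
exists c => // u v; have [gau _ _] := hxi.
have [m [s [s0 law]]] := gau 2%N (fun i => if i == ord0 then u else v)
  (fun i => if i == ord0 then 1 else -1).
pose D : {RV P >-> R} := xi u - xi v.
have DE w : D w = xi u w - xi v w by [].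
apply: (gauss4 D m s) => //.
  move=> A mA; rewrite -law//; congr (P _); apply/seteqP.
  by split => w /=; rewrite big_ord_recl big_ord1/= mul1r mulN1r.
have iuu := white_noise_integrable u u.
have iuv := white_noise_integrable u v.
have ivv := white_noise_integrable v v.
rewrite le_eqVlt; apply/orP; left; apply/eqP.
rewrite (_ : (fun w => _) = ((EFin \o (fun w => xi u w * xi u w)%R) \-
  (fun w => 2%:E * (xi u w * xi v w)%:E)) \+ (EFin \o (fun w => xi v w * xi v w)%R))%E;
  last first.
  by apply/funext => w; rewrite DE /=; congr EFin; ring.
have i2 : P.-integrable setT (fun w => 2%:E * (xi u w * xi v w)%:E)%E.
  exact: integrableZl.
rewrite integralD//; last exact: integrableB.
rewrite integralB//= integralZl//.
by rewrite !white_noise_cov -EFinM -EFinB -EFinD.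
Qed.

(** Both half-lines are covered: the increment over [[s, t]] is the white noise of
    its indicator, of squared norm [t - s], and likewise for [[-t, -s]]. *)
Lemma brownian_increment_fourth : exists2 c : R, 0 <= c &
  forall s t, 0 <= s -> s <= t ->
  (\int[P]_w ((B t w - B s w) ^+ 4)%:E <= (c * (t - s) ^+ 2)%:E)%E /\
  (\int[P]_w ((B (- t) w - B (- s) w) ^+ 4)%:E <= (c * (t - s) ^+ 2)%:E)%E.
Proof.
have [c c0 wn4] := white_noise_increment_fourth.
exists c => // s t s0 st; have t0 : 0 <= t by exact: le_trans st.
have [B0 Bpos Bneg] := hB.
have mB x y : measurable_fun setT (fun w => ((B x w - B y w) ^+ 4)%:E).
  by apply/measurable_EFinP/measurable_funX; exact: measurable_funB.
have mxi u v : measurable_fun setT (fun w => ((xi u w - xi v w) ^+ 4)%:E).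
  by apply/measurable_EFinP/measurable_funX; exact: measurable_funB.
split.
  have -> : t - s = ip (indic_itv 0 t) (indic_itv 0 t)
      - 2 * ip (indic_itv 0 t) (indic_itv 0 s) + ip (indic_itv 0 s) (indic_itv 0 s).
    by rewrite !ip_indic_itv_sub//; ring.
  apply: le_trans (wn4 _ _).
  rewrite le_eqVlt; apply/orP; left; apply/eqP; apply: ae_eq_integral => //.
  by apply: filterS2 (Bpos _ t0) (Bpos _ s0) => w -> ->.
(* the representation on the negative side extends to the origin, where [B = 0] *)
have Bneg' x : 0 <= x -> {ae P, forall w, B (- x) w = - xi (indic_itv (- x) 0) w}.
  rewrite le_eqVlt => /predU1P[<-|x0].
    rewrite oppr0; apply: filterS2 B0 (Bpos _ (lexx 0)) => w [b0 _] <-.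
    by rewrite b0 oppr0.
  by apply: Bneg; rewrite oppr_lt0.
have nt : - t <= 0 by rewrite oppr_le0.
have ns : - s <= 0 by rewrite oppr_le0.
have nst : - t <= - s by rewrite lerN2.
have -> : t - s = ip (indic_itv (- t) 0) (indic_itv (- t) 0)
    - 2 * ip (indic_itv (- t) 0) (indic_itv (- s) 0)
    + ip (indic_itv (- s) 0) (indic_itv (- s) 0).
  by rewrite !ip_indic_itv_sub//; ring.
apply: le_trans (wn4 _ _).
rewrite le_eqVlt; apply/orP; left; apply/eqP; apply: ae_eq_integral => //.
apply: filterS2 (Bneg' _ t0) (Bneg' _ s0) => w -> -> _; congr EFin.
by ring.
Qed.

End white_noise.

(** * Linear growth of Brownian motion *)

Lemma geometric_partial_sum (R : realFieldType) (x : R) (n : nat) :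
  0 <= x -> x < 1 -> \sum_(k < n) x ^+ k <= (1 - x)^-1.
Proof.
move=> x0 x1; have x10 : 0 < 1 - x by rewrite subr_gt0.
rewrite -[leRHS]mul1r ler_pdivlMr//.
have := subrX1 x n; move: (\sum_(i < n) _) => S E.
have : 0 <= x ^+ n by rewrite exprn_ge0.
by move: E; lra.
Qed.

(** A dyadic point of level [n.+1] is one of level [n] or the right neighbour of
    one, so along dyadic points [f] is bounded by a geometric series; they are
    dense and [f] is continuous. *)
Lemma dyadic_chaining (R : realType) (f : R -> R) (T M q : R) :
  continuous f -> f 0 = 0 -> 0 < T -> 0 <= M -> 0 <= q -> q < 1 ->
  (forall n j, (j < 2 ^ n)%N ->
    `|f (dyadic_pt 0 T n j.+1) - f (dyadic_pt 0 T n j)| <= M * q ^+ n) ->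
  forall t, 0 <= t -> t <= T -> `|f t| <= M * (1 - q)^-1.
Proof.
move=> cf f0 T0 M0 q0 q1 inc.
have dy n j : (j <= 2 ^ n)%N ->
    `|f (dyadic_pt 0 T n j)| <= M * \sum_(k < n.+1) q ^+ k.
  elim: n j => [|n IH] j.
    rewrite big_ord_recl big_ord0 addr0 expr0 mulr1.
    case: j => [|[|//]] _; first by rewrite dyadic_pt0 f0 normr0.
    have := inc 0%N 0%N isT; rewrite expr0 mulr1 dyadic_pt0 f0 subr0; exact.
  have even i : (i <= 2 ^ n)%N ->
      `|f (dyadic_pt 0 T n.+1 i.*2)| <= M * \sum_(k < n.+1) q ^+ k.
    by move=> il; rewrite dyadic_pt_double; exact: IH.
  have mono : M * \sum_(k < n.+1) q ^+ k <= M * \sum_(k < n.+2) q ^+ k.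
    by rewrite ler_wpM2l// [leRHS]big_ord_recr/= lerDl exprn_ge0.
  rewrite -(odd_double_half j) expnS; case: (odd j) => /= jl; last first.
    by apply: le_trans mono; apply: even; lia.
  rewrite add1n; have jh : (j./2.*2 < 2 ^ n.+1)%N by rewrite expnS; lia.
  have H1 := inc n.+1 _ jh; have H2 := even j./2 ltac:(lia).
  rewrite big_ord_recr/= mulrDr -[f _](subrK (f (dyadic_pt 0 T n.+1 j./2.*2))).
  by rewrite addrC; apply: (le_trans (ler_normD _ _)); exact: lerD.
have dy' n j : (j <= 2 ^ n)%N -> `|f (dyadic_pt 0 T n j)| <= M * (1 - q)^-1.
  move=> jn; apply: (le_trans (dy _ _ jn)); apply: ler_wpM2l => //.
  exact: geometric_partial_sum.
move=> t; rewrite le_eqVlt => /predU1P[<- _|t0 tT].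
  by rewrite f0 normr0 mulr_ge0// invr_ge0 subr_ge0 ltW.
apply/ler_addgt0Pr => e e0.
have /cvgrPdist_lt/(_ _ e0)/nbhs_ballP[r /= r0 fr] := cf t.
pose N := Num.truncn (T / r).
have Nr : T / 2 ^+ N < r.
  rewrite ltr_pdivrMr ?exprn_gt0// -ltr_pdivrMl// mulrC.
  rewrite (lt_le_trans (truncnS_gt _))// -/N -natrX ler_nat.
  exact: ltn_expl.
have [j jN] := @dyadic_cell_cover _ 0 T N t t0 tT.
rewrite /dyadic_cell/= in_itv/= => /andP[jt tj].
have := @dyadic_ptS R 0 T N j; rewrite subr0 => jS.
have /fr : ball t r (dyadic_pt 0 T N j.+1).
  by rewrite /ball/= ltr_norml; apply/andP; split; lra.
have := dy' N j.+1 jN.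
set p := f (dyadic_pt 0 T N j.+1) => H1 H2.
rewrite -[f t](subrK p); apply: (le_trans (ler_normD _ _)).
by rewrite addrC; apply: lerD => //; exact: ltW.
Qed.

Section kolmogorov.
Context {R : realType} d {Omega : measurableType d} {P : probability Omega R}.

(** On [[0, N]] the [2^n] increments of level [n] have fourth powers of total
    expectation at most [c N^2 / 2^n]. This leaves room for a factor [(8/7)^(4n)],
    which makes the increments of level [n] decay like [(7/8)^n], and for weights
    of order [N^-4], which make their size proportional to [N]. *)
Lemma fourth_moment_linear_growth (X : R -> {RV P >-> R}) (c : R) : 0 <= c ->
  (forall s t, 0 <= s -> s <= t ->
    (\int[P]_w ((X t w - X s w) ^+ 4)%:E <= (c * (t - s) ^+ 2)%:E)%E) ->
  {ae P, forall w, X 0 w = 0 /\ continuous (fun t => X t w)} ->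
  {ae P, forall w, exists2 C : R, 0 <= C &
    forall t, 0 <= t -> `|X t w| <= C * (1 + t)}.
Proof.
move=> c0 inc Xc.
pose r : R := (8 / 7) ^+ 4.
have r0 : 0 < r by rewrite exprn_gt0.
have r2 : r / 2 < 1 by rewrite /r !exprS expr0; lra.
pose p (N n j : nat) : R := dyadic_pt 0 N.+1%:R n j.
pose a (N : nat) : R := (N.+1%:R ^+ 3 * N.+2%:R)^-1.
have a0 N : 0 < a N by rewrite invr_gt0 mulr_gt0 ?exprn_gt0.
pose D N n j w : \bar R := ((X (p N n j.+1) w - X (p N n j) w) ^+ 4)%:E.
have mD N n j : measurable_fun setT (D N n j).
  by apply/measurable_EFinP/measurable_funX; exact: measurable_funB.
have D0 N n j w : (0 <= D N n j w)%E by rewrite lee_fin exprn_even_ge0.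
have intD N n j : (\int[P]_w D N n j w <= (c * (N.+1%:R / 2 ^+ n) ^+ 2)%:E)%E.
  have ple : p N n j <= p N n j.+1 by apply: dyadic_pt_le.
  have p0 : 0 <= p N n j.
    by rewrite -[leLHS](@dyadic_pt0 _ 0 N.+1%:R n); apply: dyadic_pt_le.
  by apply: (le_trans (inc _ _ p0 ple)); rewrite /p dyadic_ptS subr0.
pose G N n w : \bar R := ((a N * r ^+ n)%:E * \sum_(j < 2 ^ n) D N n j w)%E.
have mG N n : measurable_fun setT (G N n).
  apply: emeasurable_funM; first exact: measurable_cst.
  by apply: emeasurable_sum => j; exact: mD.
have ar0 N n : 0 <= a N * r ^+ n by rewrite mulr_ge0 ?exprn_ge0// ltW.
have G0 N n w : (0 <= G N n w)%E.
  by apply: mule_ge0; [rewrite lee_fin|apply: sume_ge0].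
pose u N : R := c * (N.+1%:R^-1 - N.+2%:R^-1).
have intG N n : (\int[P]_w G N n w <= (u N * (r / 2) ^+ n)%:E)%E.
  rewrite ge0_integralZl//; last 3 first.
  - by apply: emeasurable_sum => j; exact: mD.
  - by move=> w _; apply: sume_ge0.
  - by rewrite lee_fin.
  rewrite ge0_integral_sum//.
  apply: (@le_trans _ _ ((a N * r ^+ n)%:E *
      \sum_(j < 2 ^ n) (c * (N.+1%:R / 2 ^+ n) ^+ 2)%:E)%E).
    apply: lee_wpmul2l; first by rewrite lee_fin.
    by apply: lee_sum => j _; exact: intD.
  rewrite sumEFin -EFinM lee_fin sumr_const card_ord -[X in _ * X <= _]mulr_natr natrX.
  rewrite le_eqVlt; apply/orP; left; apply/eqP.
  rewrite /u /a !expr_div_n; have n1 : N.+1%:R != 0 :> R by rewrite pnatr_eq0.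
  have n2 : N.+2%:R != 0 :> R by rewrite pnatr_eq0.
  have n21 : N.+2%:R = N.+1%:R + 1 :> R by rewrite natr1.
  have t0 : (2 : R) ^+ n != 0 by rewrite expf_neq0.
  move: n1 n2; rewrite n21; move: (N.+1%:R) (2 ^+ n) t0 (r ^+ n) => x y y0 z x0 x1.
  by field; rewrite x0 x1 y0.
have u0 N : 0 <= u N.
  by rewrite mulr_ge0// subr_ge0 lef_pV2 ?posrE// ler_nat.
pose H N w : \bar R := (\sum_(n <oo) G N n w)%E.
have mH N : measurable_fun setT (H N).
  by apply: ge0_emeasurable_sum => // n x _ _; exact: G0.
have H0 N w : (0 <= H N w)%E by exact: nneseries_ge0.
pose g : R := (1 - r / 2)^-1.
have g0 : 0 <= g by rewrite invr_ge0 subr_ge0 ltW.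
have intH N : (\int[P]_w H N w <= (u N * g)%:E)%E.
  apply: (@summable_integral_series _ _ _ P (G N) (fun n => u N * (r / 2) ^+ n)) => //.
  move=> M; rewrite -mulr_sumr; apply: ler_wpM2l => //.
  by apply: geometric_partial_sum => //; rewrite divr_ge0// ltW.
have uc M : \sum_(N < M) u N * g <= c * g.
  rewrite -mulr_suml ler_wpM2r// -mulr_sumr.
  rewrite -(big_mkord xpredT (fun n => n.+1%:R^-1 - n.+2%:R^-1 : R)).
  rewrite (eq_bigr (fun n => - n.+2%:R^-1 - - n.+1%:R^-1)); last first.
    by move=> n _; rewrite opprK addrC.
  rewrite telescope_sumr// opprK invr1 ler_piMr//.
have := summable_integral_ae_bounded mH H0 intH uc.
move: Xc; apply: filterS2 => w [X0 cX] [C C0 HC].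
exists ((1 + 2 * C) * (1 - 7 / 8)^-1).
  by rewrite mulr_ge0 ?invr_ge0//; lra.
move=> t t0; pose N := Num.truncn t.
have Nt : N%:R <= t by rewrite truncn_le.
have tN : t <= N.+1%:R by rewrite ltW// truncnS_gt.
have N1 : 1 <= N.+1%:R :> R by rewrite ler1n.
have M0 : 0 <= (1 + 2 * C) * N.+1%:R by rewrite mulr_ge0//; lra.
have incw n j : (j < 2 ^ n)%N ->
    `|X (p N n j.+1) w - X (p N n j) w| <= (1 + 2 * C) * N.+1%:R * (7 / 8) ^+ n.
  move=> jn; set x := X _ _ - X _ _.
  have GC : (G N n w <= C%:E)%E.
    apply: le_trans (HC N); rewrite /H.
    apply: (@le_trans _ _ (\sum_(0 <= k < n.+1) G N k w)%E).
      by rewrite big_nat_recr//= leeDr// sume_ge0.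
    by apply: nneseries_lim_ge => k _.
  have {GC} : a N * r ^+ n * x ^+ 4 <= C.
    rewrite -lee_fin; apply: le_trans GC; rewrite /G EFinM.
    apply: lee_wpmul2l; first by rewrite lee_fin.
    rewrite (bigD1 (Ordinal jn))//= leeDl//.
    by apply: sume_ge0.
  (* the weight [r^n] is exactly what turns the fourth root into [(7/8)^n] *)
  have rn : r ^+ n * ((7 / 8) ^+ n) ^+ 4 = 1.
    by rewrite -exprM mulnC exprM -exprMn /r -exprMn (_ : 8 / 7 * (7 / 8) = 1) ?expr1n//; field.
  set q := (7 / 8) ^+ n in rn *.
  have q0 : 0 <= q by rewrite exprn_ge0.
  have n21 : N.+2%:R = N.+1%:R + 1 :> R by rewrite natr1.
  rewrite /a n21; move: N1 M0; set y := (N.+1%:R : R) => y1 M0 xC.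
  have y0 : 0 < y by lra.
  have ay : 0 < y ^+ 3 * (y + 1) by rewrite mulr_gt0 ?exprn_gt0//; lra.
  have q40 : 0 <= q ^+ 4 by rewrite exprn_ge0.
  have x4 : x ^+ 4 <= 2 * C * y ^+ 4 * q ^+ 4.
    have : x ^+ 4 = (y ^+ 3 * (y + 1)) * q ^+ 4 * ((y ^+ 3 * (y + 1))^-1 * r ^+ n * x ^+ 4).
      have yy : (y ^+ 3 * (y + 1)) * (y ^+ 3 * (y + 1))^-1 = 1.
        by rewrite mulfV// gt_eqF.
      transitivity ((y ^+ 3 * (y + 1)) * (y ^+ 3 * (y + 1))^-1 *
        (r ^+ n * q ^+ 4) * x ^+ 4); first by rewrite yy rn !mul1r.
      by move: (_^-1) => z; ring.
    move=> ->; apply: (@le_trans _ _ (y ^+ 3 * (y + 1) * q ^+ 4 * C)).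
      by apply: ler_wpM2l => //; rewrite mulr_ge0// ltW.
    have y34 : y ^+ 3 * (y + 1) <= 2 * y ^+ 4.
      by have : 0 <= y ^+ 3 by [rewrite exprn_ge0// ltW]; nra.
    rewrite (_ : 2 * C * y ^+ 4 * q ^+ 4 = 2 * y ^+ 4 * (q ^+ 4 * C)); last by ring.
    by rewrite -mulrA; apply: ler_wpM2r => //; exact: mulr_ge0.
  have C12 : 0 <= 1 + 2 * C by lra.
  rewrite -(@ler_pXn2r _ 4%N) ?nnegrE ?mulr_ge0//.
  rewrite -normrX ger0_norm ?exprn_even_ge0//; apply: (le_trans x4).
  rewrite !exprMn; do 2 (apply: ler_wpM2r; first by rewrite ?exprn_even_ge0).
  have : 1 + 2 * C <= (1 + 2 * C) ^+ 4 by apply: ler_eXnr => //; lra.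
  by lra.
have T0 : 0 < N.+1%:R :> R by [].
have q0 : 0 <= 7 / 8 :> R by lra.
have q1 : 7 / 8 < 1 :> R by lra.
have := dyadic_chaining cX X0 T0 M0 q0 q1 incw t0 tN.
move=> /le_trans; apply; rewrite -!mulrA; apply: ler_wpM2l; first by lra.
rewrite mulrC; apply: ler_wpM2l; first by rewrite invr_ge0; lra.
by rewrite -natr1 addrC lerD2l.
Qed.

End kolmogorov.

Section brownian.
Context {R : realType} d {Omega : measurableType d} {P : probability Omega R}.
Variables (xi : L2 R -> {RV P >-> R}) (B : R -> {RV P >-> R}).

Lemma brownian_linear_growth : white_noise xi -> brownian_of xi B ->
  {ae P, forall w, continuous (fun t => B t w) /\
    exists2 C : R, 0 <= C & forall t, `|B t w| <= C * (1 + `|t|)}.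
Proof.
move=> hxi hB; have [c c0 B4] := brownian_increment_fourth hxi hB.
have [Bc _ _] := hB.
have pos := fourth_moment_linear_growth c0 (fun s t s0 st => (B4 s t s0 st).1) Bc.
have neg := @fourth_moment_linear_growth _ _ _ P (fun t => B (- t)) c c0
  (fun s t s0 st => (B4 s t s0 st).2).
have {}neg : {ae P, forall w, exists2 C : R, 0 <= C &
    forall t, 0 <= t -> `|B (- t) w| <= C * (1 + t)}.
  apply: neg; move: Bc; apply: filterS => w [B0 cB]; split; first by rewrite oppr0.
  move=> t; apply: (@continuous_comp _ _ _ -%R (fun t => B t w)).
    exact: (@oppr_continuous _ R^o).
  exact: cB.
move: Bc pos neg; apply: filterS3 => w [_ cB] [C1 C10 H1] [C2 C20 H2].
split => //; exists (C1 + C2); first exact: addr_ge0.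
move=> t; rewrite mulrDl; have t0 := normr_ge0 t.
have e1 : 0 <= C1 * (1 + `|t|) by rewrite mulr_ge0// addr_ge0.
have e2 : 0 <= C2 * (1 + `|t|) by rewrite mulr_ge0// addr_ge0.
have [tp|tn] := leP 0 t.
  by apply: (le_trans (H1 _ tp)); rewrite -[X in 1 + X](ger0_norm tp) lerDl.
have nt : 0 <= - t by rewrite oppr_ge0 ltW.
have := H2 _ nt; rewrite opprK => /le_trans; apply.
by rewrite -[X in 1 + X](ger0_norm nt) normrN lerDr.
Qed.

End brownian.

(** * Subexponential growth of the generalized eigenfunctions *)

Unset Implicit Arguments.

Theorem proposition5p6 (R : realType) (d : measure_display)
    (Omega : measurableType d) (P : probability Omega R)
    (xi : L2 R -> {RV P >-> R}) (B : R -> {RV P >-> R})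
    (hxi : white_noise xi) (hB : brownian_of xi B) :
  {ae P, forall w,
    forall (E : set R -> L2 R -> L2 R)
      (rho : {measure set (measurableTypeR R) -> \bar R})
      (K : R -> R -> R -> R) (m : R -> nat)
      (phi : forall l : R, 'I_(m l) -> R -> R),
    pvm_of (anderson (fun t => B t w)) E ->
    spectral_measure E rho ->
    eigen_disintegration (fun t => B t w) E rho K phi ->
    {ae rho, forall l, forall i : 'I_(m l),
      ((ln (1 + `|phi l i x|) / `|x|) @[x --> +oo] --> (0 : R)) /\
      ((ln (1 + `|phi l i x|) / `|x|) @[x --> -oo] --> (0 : R))}}.
Proof.
move: (brownian_linear_growth hxi hB); apply: filterS => w [cB [C C0 BC]].
move=> E rho K m phi [pvmE _ _] _ disK.
exact: (eigenfunction_growth cB pvmE disK C0 BC).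
Qed.
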